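(* Let $k$ be a finite field containing $\mathbb{F}_q$, with algebraic closure $\bar k$, and let $M$ be an $F_{\mathfrak p}$-isocrystal over $k$. Then $$\mathrm{char}_M(X)=\det\nolimits_{\mathcal{E}_{F_{\mathfrak p},\bar k}}\bigl(X\cdot\mathrm{id}-\mathrm{Frob}_k^{-1}\bigm|U(M)\bigr),$$ where $\mathrm{Frob}_k\in W_k$ is the arithmetic Frobenius $\xi\mapsto\xi^{|k|}$.
   Context: $F_{\mathfrak p}$ is a nonarchimedean local field containing the finite field $\mathbb{F}_q$. For a field $K\supset\mathbb{F}_q$ (discrete) let $\mathcal{E}_{F_{\mathfrak p},K}:=F_{\mathfrak p}\widehat\otimes_{\mathbb{F}_q}K$, $\sigma(a\widehat\otimes\xi):=a\widehat\otimes\xi^q$. An $F_{\mathfrak p}$-isocrystal over $K$ is a finitely generated projective (automatically free) $\mathcal{E}_{F_{\mathfrak p},K}$-module $M$ with an additive map $\tau_M:M\to M$, $\tau_M(em)=\sigma(e)\tau_M(m)$, whose linearization $\sigma^*M\to M$ is an isomorphism. Morphisms are linear maps commuting with $\tau$. For $k$ finite, $\mathcal{E}_{F_{\mathfrak p},k}=F_{\mathfrak p}\otimes_{\mathbb{F}_q}k$, the map $\tau_M^{[k/\mathbb{F}_q]}$ is $\mathcal{E}_{F_{\mathfrak p},k}$-linear, and $\mathrm{char}_M(X):=\det_{\mathcal{E}_{F_{\mathfrak p},k}}(X\cdot\mathrm{id}_M-\tau_M^{[k/\mathbb{F}_q]})$, which has coefficients in $F_{\mathfrak p}$. $W_k\subset\mathrm{Gal}(\bar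 k/k)$ is the subgroup generated by $\mathrm{Frob}_k$; for $\gamma\in W_k$, $\deg_q(\gamma)\in\mathbb{Z}$ is defined by $\gamma=\mathrm{Frob}_q^{\deg_q(\gamma)}$ with $\mathrm{Frob}_q:\xi\mapsto\xi^q$ on $\bar k$. For an isocrystal $P$ over $\bar k$, $T_P(M)$ is the right $\mathrm{End}(P)$-module of $\mathcal{E}_{F_{\mathfrak p},\bar k}$-linear $\tau$-equivariant maps $P\to M\widehat\otimes_k\bar k$ (base change to $\bar k$), with $\gamma\in W_k$ acting by $f\mapsto(\mathrm{id}\widehat\otimes\gamma)\circ f\circ\tau_P^{-\deg_q(\gamma)}$; $U_P(M):=T_P(M)\otimes_{\mathrm{End}(P)}P$ with $W_k$ acting through the first factor. If there are $\iota:P\to P'$, $\pi:P'\to P$ with $\pi\iota=\mathrm{id}$, then $h\otimes p\mapsto(h\circ\pi)\otimes\iota(p)$ defines a map $U_P(M)\to U_{P'}(M)$, independent of $\iota,\pi$; these form a filtered, eventually constant direct system, and $U(M):=\varinjlim_PU_P(M)$, a free $\mathcal{E}_{F_{\mathfrak p},\bar k}$-module of rank $\operatorname{rank}(M)$ with a linear action of $W_k$. *)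

(* Defs.v *)
From HB Require Import structures.
From mathcomp Require Import all_boot all_order all_fingroup all_algebra all_field.
From mathcomp Require Import ring_quotient generic_quotient.
From mathcomp Require Import boolp classical_sets functions.

Set Implicit Arguments.
Unset Strict Implicit.
Unset Printing Implicit Defensive.

Import Order.TTheory GRing.Theory Num.Theory.
Local Open Scope ring_scope.
Local Open Scope quotient_scope.

(* [tensor ra la] is the tensor product of A and B balanced over R, where R
   acts on A from the right by [ra] and on B from the left by [la].  Its
   elements are finite formal sums of pairs, two of them being identified
   when every balanced biadditive map to an abelian group agrees on them.    *)
Section Tensor.

Variables (A B : zmodType) (R : Type) (ra : A -> R -> A) (la : R -> B -> B).

Record balanced (G : zmodType) (b : A -> B -> G) : Prop := Balanced {
  balDl : forall x y z, b (x + y) z = b x z + b y z;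
  balDr : forall x y z, b x (y + z) = b x y + b x z;
  balM : forall x r y, b (ra x r) y = b x (la r y) }.

Definition tsum (G : zmodType) (b : A -> B -> G) (s : seq (A * B)) : G :=
  \sum_(p <- s) b p.1 p.2.

Definition tequiv : rel (seq (A * B)) := fun s t =>
  `[< forall (G : zmodType) (b : A -> B -> G),
        balanced b -> tsum b s = tsum b t >].

Lemma tequivP s t : reflect (forall (G : zmodType) (b : A -> B -> G),
  balanced b -> tsum b s = tsum b t) (tequiv s t).
Proof. exact: asboolP. Qed.

Lemma tequiv_equiv : equiv_class_of tequiv.
Proof.
split.
- by move=> s; apply/tequivP.
- by move=> s t; apply/tequivP/tequivP => H G b hb; rewrite H.
- move=> t s u /tequivP H1 /tequivP H2; apply/tequivP => G b hb.
  by rewrite H1 // H2.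
Qed.
Canonical tequiv_equivRel := EquivRelPack tequiv_equiv.
Canonical tequiv_encModRel := defaultEncModRel tequiv.

Definition tensor : Type := {eq_quot tequiv}.
HB.instance Definition _ := Choice.on tensor.
HB.instance Definition _ : EqQuotient (seq (A * B)) tequiv tensor :=
  EqQuotient.on tensor.

Definition tpi (s : seq (A * B)) : tensor := \pi_tensor s.
Definition pure (a : A) (b : B) : tensor := tpi [:: (a, b)].
Definition tlift (G : zmodType) (b : A -> B -> G) (x : tensor) : G :=
  tsum b (repr x).

Lemma tpiP s t : tpi s = tpi t <-> forall (G : zmodType) (b : A -> B -> G),
  balanced b -> tsum b s = tsum b t.
Proof.
rewrite /tpi; split=> [/eqmodP/tequivP //|H].
by apply/eqmodP/tequivP.
Qed.

Lemma tpi_repr x : tpi (repr x) = x. Proof. exact: reprK. Qed.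

Lemma tlift_tpi (G : zmodType) (b : A -> B -> G) s :
  balanced b -> tlift b (tpi s) = tsum b s.
Proof. by move=> hb; apply: (proj1 (tpiP _ _) (tpi_repr _)). Qed.

Definition tadd (x y : tensor) := tpi (repr x ++ repr y).
Definition topp (x : tensor) := tpi [seq (- p.1, p.2) | p <- repr x].

Lemma tsum_cat (G : zmodType) (b : A -> B -> G) s t :
  tsum b (s ++ t) = tsum b s + tsum b t.
Proof. by rewrite /tsum big_cat. Qed.

Lemma tsum_cons (G : zmodType) (b : A -> B -> G) p s :
  tsum b (p :: s) = b p.1 p.2 + tsum b s.
Proof. by rewrite /tsum big_cons. Qed.

Lemma tsum_nil (G : zmodType) (b : A -> B -> G) : tsum b [::] = 0.
Proof. by rewrite /tsum big_nil. Qed.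

Lemma bal0l (G : zmodType) (b : A -> B -> G) y : balanced b -> b 0 y = 0.
Proof.
by move=> hb; apply: (@addrI _ (b 0 y)); rewrite -(balDl hb) !addr0.
Qed.

Lemma bal0r (G : zmodType) (b : A -> B -> G) x : balanced b -> b x 0 = 0.
Proof.
by move=> hb; apply: (@addrI _ (b x 0)); rewrite -(balDr hb) !addr0.
Qed.

Lemma balNl (G : zmodType) (b : A -> B -> G) x y :
  balanced b -> b (- x) y = - b x y.
Proof.
by move=> hb; apply: (@addrI _ (b x y)); rewrite -(balDl hb) !subrr bal0l.
Qed.

Lemma tsum_opp (G : zmodType) (b : A -> B -> G) s : balanced b ->
  tsum b [seq (- p.1, p.2) | p <- s] = - tsum b s.
Proof.
move=> hb; elim: s => [|p s IHs] /=; first by rewrite !tsum_nil oppr0.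
by rewrite !tsum_cons /= IHs balNl // opprD.
Qed.

Lemma tadd_tpi s t : tadd (tpi s) (tpi t) = tpi (s ++ t).
Proof.
apply/tpiP => G b hb; rewrite !tsum_cat.
by rewrite -!/(tlift b _) !tlift_tpi.
Qed.

Lemma topp_tpi s : topp (tpi s) = tpi [seq (- p.1, p.2) | p <- s].
Proof.
apply/tpiP => G b hb; rewrite !tsum_opp //.
by rewrite -!/(tlift b _) !tlift_tpi.
Qed.

Lemma tensorA : associative tadd.
Proof.
move=> x y z; rewrite -(tpi_repr x) -(tpi_repr y) -(tpi_repr z).
by rewrite !tadd_tpi catA.
Qed.

Lemma tensorC : commutative tadd.
Proof.
move=> x y; rewrite -(tpi_repr x) -(tpi_repr y) !tadd_tpi.
by apply/tpiP => G b hb; rewrite !tsum_cat addrC.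
Qed.

Lemma tensor0 : left_id (tpi [::]) tadd.
Proof. by move=> x; rewrite -(tpi_repr x) tadd_tpi. Qed.

Lemma tensorN : left_inverse (tpi [::]) topp tadd.
Proof.
move=> x; rewrite -(tpi_repr x) topp_tpi tadd_tpi.
by apply/tpiP => G b hb; rewrite tsum_cat tsum_opp // addNr tsum_nil.
Qed.

HB.instance Definition _ :=
  GRing.isZmodule.Build tensor tensorA tensorC tensor0 tensorN.

Lemma tpi_cat s t : tpi (s ++ t) = tpi s + tpi t.
Proof. by rewrite -tadd_tpi. Qed.

Lemma tpi_nil : tpi [::] = 0. Proof. by []. Qed.

Lemma tpi_cons p s : tpi (p :: s) = pure p.1 p.2 + tpi s.
Proof. by rewrite -cat1s tpi_cat; case: p. Qed.

Lemma tpi_opp s : - tpi s = tpi [seq (- p.1, p.2) | p <- s].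
Proof. by rewrite -topp_tpi. Qed.

Lemma pure_balanced : balanced pure.
Proof.
split=> *; rewrite /pure -?tpi_cat; apply/tpiP => G b hb;
  by rewrite !(tsum_cons, tsum_nil) ?addr0 /= (balDl, balDr, balM).
Qed.

Lemma tlift_pure (G : zmodType) (b : A -> B -> G) x y :
  balanced b -> tlift b (pure x y) = b x y.
Proof. by move=> hb; rewrite tlift_tpi // tsum_cons tsum_nil addr0. Qed.

Lemma tliftD (G : zmodType) (b : A -> B -> G) : balanced b ->
  {morph tlift b : x y / x + y}.
Proof.
move=> hb x y; rewrite -(tpi_repr x) -(tpi_repr y) -tpi_cat.
by rewrite !tlift_tpi // tsum_cat.
Qed.

Lemma tlift0 (G : zmodType) (b : A -> B -> G) : balanced b -> tlift b 0 = 0.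
Proof. by move=> hb; rewrite -tpi_nil tlift_tpi // tsum_nil. Qed.

Lemma tensor_ind (P : tensor -> Prop) :
  P 0 -> (forall a b x, P x -> P (pure a b + x)) -> forall x, P x.
Proof.
move=> P0 PS x; rewrite -(tpi_repr x); elim: (repr x) => [|p s IHs] //.
by rewrite tpi_cons; apply: PS.
Qed.

Lemma tensor_ext (G : zmodType) (f g : tensor -> G) :
  {morph f : x y / x + y} -> {morph g : x y / x + y} ->
  (forall a b, f (pure a b) = g (pure a b)) -> f =1 g.
Proof.
move=> fD gD fg x.
have f0 : f 0 = 0 by apply: (@addrI _ (f 0)); rewrite -fD !addr0.
have g0 : g 0 = 0 by apply: (@addrI _ (g 0)); rewrite -gD !addr0.
elim/tensor_ind: x => [|a b x IHx]; first by rewrite f0 g0.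
by rewrite fD gD fg IHx.
Qed.

End Tensor.

Arguments tensor {A B R} ra la.
Arguments pure {A B R ra la} a b.
Arguments tlift {A B R ra la G} b x.

(* [vpow v n] is the set of x with v(x) >= n, that is, the n-th power of the
   maximal ideal; the value of v at 0 is irrelevant.                         *)
Definition vpow (L : fieldType) (v : L -> int) (n : int) (x : L) : bool :=
  (x == 0) || (n <= v x).

Record localField (Fq : finFieldType) := LocalField {
  lf_sort :> fieldType;
  lf_emb : {rmorphism Fq -> lf_sort};
  lf_val : lf_sort -> int;
  lf_valM : forall x y, x != 0 -> y != 0 ->
    lf_val (x * y) = lf_val x + lf_val y;
  lf_valD : forall x y, x != 0 -> y != 0 -> x + y != 0 ->
    Num.min (lf_val x) (lf_val y) <= lf_val (x + y);
  lf_unif : exists2 pi, pi != 0 & lf_val pi = 1;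
  lf_complete : forall u : nat -> lf_sort,
    (forall n : int, exists N, forall i j, (N <= i)%N -> (N <= j)%N ->
       vpow lf_val n (u i - u j)) ->
    exists l, forall n : int, exists N, forall i, (N <= i)%N ->
      vpow lf_val n (u i - l);
  lf_residue : exists s : seq lf_sort, forall x, vpow lf_val 0 x ->
    exists2 y, y \in s & vpow lf_val 1 (x - y) }.

Section LocalFieldTheory.
Variables (Fq : finFieldType) (F : localField Fq).
Local Notation v := (@lf_val Fq F).
Local Notation emb := (@lf_emb Fq F).

Lemma vpowD n x y : vpow v n x -> vpow v n y -> vpow v n (x + y).
Proof.
rewrite /vpow; case: (eqVneq x 0) => [-> _|x0 /= hx]; first by rewrite add0r.
case: (eqVneq y 0) => [-> _|y0 /= hy]; first by rewrite addr0 hx orbT.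
case: (eqVneq (x + y) 0) => //= xy0; apply: le_trans (lf_valD x0 y0 xy0).
by rewrite le_min hx hy.
Qed.

Lemma vpowM m n x y : vpow v m x -> vpow v n y -> vpow v (m + n) (x * y).
Proof.
rewrite /vpow; case: (eqVneq x 0) => [-> _|x0 /= hx].
  by rewrite mul0r eqxx.
case: (eqVneq y 0) => [-> _|y0 /= hy]; first by rewrite mulr0 eqxx.
by rewrite lf_valM // lerD ?orbT.
Qed.

Lemma vpow_leq m n x : m <= n -> vpow v n x -> vpow v m x.
Proof.
by move=> mn; rewrite /vpow => /orP[->//|/(le_trans mn) ->]; rewrite orbT.
Qed.

Lemma lf_val1 : v 1 = 0.
Proof.
have := @lf_valM _ F 1 1 (oner_neq0 _) (oner_neq0 _).
by rewrite mulr1 => /eqP; rewrite -subr_eq0 opprD addNKr oppr_eq0 => /eqP.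
Qed.

Lemma lf_valX x n : x != 0 -> v (x ^+ n) = (v x) *+ n.
Proof.
move=> x0; elim: n => [|n IHn]; first by rewrite expr0 lf_val1 mulr0n.
by rewrite exprS lf_valM ?expf_neq0 // IHn mulrS.
Qed.

Lemma lf_val_emb c : c != 0 -> v (emb c) = 0.
Proof.
move=> c0; have e0 : emb c != 0 by rewrite fmorph_eq0.
have := lf_valX #|Fq|.-1 e0; rewrite -rmorphXn.
have -> : c ^+ #|Fq|.-1 = 1.
  apply: (mulfI c0); rewrite -exprS prednK; first by rewrite expf_card mulr1.
  by apply/card_gt0P; exists 0.
rewrite rmorph1 lf_val1 => /esym/eqP; rewrite mulrn_eq0 => /orP[|/eqP//].
have := card_finRing_gt1 Fq.
by case: #|Fq| => [|[]].
Qed.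

Lemma vpow_emb c : vpow v 0 (emb c).
Proof.
rewrite /vpow; case: (eqVneq c 0) => [->|c0]; first by rewrite rmorph0 eqxx.
by rewrite lf_val_emb // lexx orbT.
Qed.

Lemma vpowZ n c x : vpow v n x -> vpow v n (emb c * x).
Proof. by move=> hx; rewrite -[n]add0r vpowM // vpow_emb. Qed.

Lemma vpowN n x : vpow v n x -> vpow v n (- x).
Proof. by move/(vpowZ (-1)); rewrite rmorphN1 mulN1r. Qed.

Lemma vpow1 : ~~ vpow v 1 1.
Proof. by rewrite /vpow oner_eq0 lf_val1. Qed.

Lemma vpow_ex x : exists n, vpow v n x.
Proof. by exists (v x); rewrite /vpow lexx orbT. Qed.

Lemma lf_functional : exists lam : F -> Fq,
  [/\ {morph lam : x y / x + y}, forall c x, lam (emb c * x) = c * lam x,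
      lam 1 = 1 & forall x, vpow v 1 x -> lam x = 0].
Proof.
pose P (W : set F) := [/\ forall c x y, W x -> W y -> W (emb c * x + y),
  ~ W 1 & forall w x, W w -> vpow v 1 x -> W x].
have [W [[Wl W1 Wm] Wmax]] : exists W, P W /\ forall B, (W `<` B)%classic -> ~ P B.
  apply: Zorn_bigcup => C CP Ctot; split.
  - move=> c x y [X CX Xx] [Y CY Yy].
    have [XY|YX] := Ctot _ _ CX CY.
    + by exists Y => //; case: (CP _ CY) => H _ _; apply: H => //; apply: XY.
    + by exists X => //; case: (CP _ CX) => H _ _; apply: H => //; apply: YX.
  - by move=> [X CX X1]; case: (CP _ CX).
  - move=> w x [X CX Xw] hx; exists X => //.
    by case: (CP _ CX) => _ _ H; apply: (H w).
have [w Ww] : exists w, W w.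
  apply: contrapT => noW; apply: (Wmax (fun x => vpow v 1 x)).
    split=> [x Wx|sub]; first by case: noW; exists x.
    by apply: noW; exists 0; apply: sub; rewrite /vpow eqxx.
  split.
  - by move=> c x y hx hy; apply: vpowD => //; apply: vpowZ.
  - by apply/negP; exact: vpow1.
  - by [].
have W0 : W 0 by apply: (Wm _ _ Ww); rewrite /vpow eqxx.
have WZ c x : W x -> W (emb c * x) by move=> Wx; rewrite -[_ * _]addr0; apply: Wl.
have WD x y : W x -> W y -> W (x + y).
  by move=> Wx Wy; rewrite -[x]mul1r -(rmorph1 emb); apply: Wl.
have WN x : W x -> W (- x).
  by move=> Wx; rewrite -mulN1r -(rmorphN1 emb); apply: WZ.
have ex x : exists c, W (x - emb c).
  apply: contrapT => noc.
  apply: (Wmax (fun y => exists c a, W a /\ y = a + emb c * x)).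
    split=> [y Wy|sub]; first by exists 0, y; rewrite rmorph0 mul0r addr0.
    apply: noc; exists 0; rewrite rmorph0 subr0; apply: sub.
    by exists 1, 0; rewrite rmorph1 mul1r add0r.
  split.
  - move=> c y z [cy [a [Wa ->]]] [cz [b [Wb ->]]].
    exists (c * cy + cz), (emb c * a + b); split; first exact: Wl.
    by rewrite rmorphD rmorphM mulrDr mulrDl mulrA addrACA.
  - move=> [c [a [Wa e]]]; have [c0|c0] := eqVneq c 0.
      by apply: W1; rewrite e c0 rmorph0 mul0r addr0.
    apply: noc; exists c^-1.
    have -> : x - emb c^-1 = emb (- c^-1) * a.
      have e0 : emb c != 0 by rewrite fmorph_eq0.
      apply: (mulfI e0); rewrite mulrBr mulrA -!rmorphM mulrN divff // rmorph1.
      by rewrite rmorphN1 mulN1r e opprD addrCA subrr addr0.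
    exact: WZ.
  - by move=> _ y _ hy; exists 0, y; split; [apply: Wm Ww hy|rewrite rmorph0 mul0r addr0].
have uniq x c d : W (x - emb c) -> W (x - emb d) -> c = d.
  move=> Wc Wd; apply: contrapT => /eqP cd; apply: W1.
  have cd0 : c - d != 0 by rewrite subr_eq0.
  have -> : 1 = emb (c - d)^-1 * ((x - emb d) - (x - emb c)).
    rewrite opprB [X in _ * X]addrC subrKA -rmorphB -rmorphM mulVf ?rmorph1 //.
  by apply: WZ; apply: WD => //; apply: WN.
pose lam x := projT1 (cid (ex x)).
have lamP x : W (x - emb (lam x)) by rewrite /lam; case: cid.
exists lam; split.
- move=> x y; apply: (uniq (x + y)) => //.
  by rewrite rmorphD opprD addrACA; apply: WD.
- move=> c x; apply: (uniq (emb c * x)) => //.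
  by rewrite rmorphM -mulrBr; apply: WZ.
- by apply: (uniq 1) => //; rewrite rmorph1 subrr.
- by move=> x hx; apply: (uniq x) => //; rewrite rmorph0 subr0; exact: (Wm _ _ Ww).
Qed.

End LocalFieldTheory.

Section AlgTensor.
Variables (Fq : finFieldType) (F : localField Fq) (K : fieldType).
Variable (j : {rmorphism Fq -> K}).
Local Notation v := (@lf_val Fq F).
Local Notation emb := (@lf_emb Fq F).

Definition FK_ra (a : F) (c : Fq) : F := a * emb c.
Definition FK_la (c : Fq) (x : K) : K := j c * x.
(* F (x)_Fq K as a ring *)
Definition algtens : Type := tensor FK_ra FK_la.
HB.instance Definition _ := GRing.Zmodule.on algtens.

Local Notation pr := (pure : F -> K -> algtens).

Lemma pureDl x y z : pr (x + y) z = pr x z + pr y z.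
Proof. exact: (balDl (pure_balanced FK_ra FK_la)). Qed.
Lemma pureDr x y z : pr x (y + z) = pr x y + pr x z.
Proof. exact: (balDr (pure_balanced FK_ra FK_la)). Qed.
Lemma pureM x c z : pr (x * emb c) z = pr x (j c * z).
Proof. exact: (balM (pure_balanced FK_ra FK_la)). Qed.

Definition mul1 (a : F) (c : K) : algtens -> algtens :=
  tlift (fun a' c' => pr (a * a') (c * c')).
Definition algtens_mul (x y : algtens) : algtens :=
  tlift (fun a c => mul1 a c y) x.

Lemma mul1_bal a c : balanced FK_ra FK_la (fun a' c' => pr (a * a') (c * c')).
Proof.
split=> [x y z|x y z|x r y]; rewrite ?mulrDr ?pureDl ?pureDr //.
by rewrite /FK_ra /FK_la mulrA pureM mulrCA.
Qed.

Lemma mul1E a c a' c' : mul1 a c (pr a' c') = pr (a * a') (c * c').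
Proof. by rewrite /mul1 tlift_pure //; exact: mul1_bal. Qed.

Lemma mul1D a c : {morph mul1 a c : x y / x + y}.
Proof. exact: tliftD (mul1_bal a c). Qed.

Lemma mul_bal y : balanced FK_ra FK_la (fun a c => mul1 a c y).
Proof.
split=> [a a' c|a c c'|a r c].
- apply: (tensor_ext (g := fun y => mul1 a c y + mul1 a' c y)) y.
  + exact: mul1D.
  + by move=> x y; rewrite !mul1D addrACA.
  + by move=> b d; rewrite !mul1E mulrDl pureDl.
- apply: (tensor_ext (g := fun y => mul1 a c y + mul1 a c' y)) y.
  + exact: mul1D.
  + by move=> x y; rewrite !mul1D addrACA.
  + by move=> b d; rewrite !mul1E mulrDl pureDr.
- apply: (tensor_ext _ _ _ y) => [||b d]; try exact: mul1D.
  by rewrite !mul1E /FK_ra /FK_la mulrAC pureM mulrA.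
Qed.

Lemma algtens_mulDl : left_distributive algtens_mul +%R.
Proof. by move=> x y z; rewrite /algtens_mul (tliftD (mul_bal z)). Qed.

Lemma algtens_mulE a c a' c' :
  algtens_mul (pr a c) (pr a' c') = pr (a * a') (c * c').
Proof. by rewrite /algtens_mul tlift_pure ?mul1E //; exact: mul_bal. Qed.

Lemma algtens_mulC : commutative algtens_mul.
Proof.
have mulDr_pure a c : {morph algtens_mul (pr a c) : x y / x + y}.
  by move=> x y; rewrite /algtens_mul !tlift_pure ?mul1D //; exact: mul_bal.
have mulDr : forall z, {morph algtens_mul z : x y / x + y}.
  move=> z x y.
  apply: (tensor_ext (f := fun z => algtens_mul z (x + y))
    (g := fun z => algtens_mul z x + algtens_mul z y)) z => [z t|z t|a c].
  - exact: algtens_mulDl.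
  - by rewrite !algtens_mulDl addrACA.
  - exact: mulDr_pure.
move=> x y; apply: (tensor_ext (f := fun x => algtens_mul x y)
    (g := algtens_mul y)) x => [z t|z t|a c].
- exact: algtens_mulDl.
- exact: mulDr.
apply: (tensor_ext (f := algtens_mul (pr a c))
    (g := fun y => algtens_mul y (pr a c))) y => [z t|z t|a' c'].
- exact: mulDr.
- exact: algtens_mulDl.
- by rewrite !algtens_mulE mulrC [c * _]mulrC.
Qed.

Lemma algtens_mulDr z : {morph algtens_mul z : x y / x + y}.
Proof.
by move=> x y; rewrite !(algtens_mulC z) algtens_mulDl.
Qed.

Lemma algtens_mulA : associative algtens_mul.
Proof.
move=> x y z.
apply: (tensor_ext (f := fun x => algtens_mul x (algtens_mul y z))
  (g := fun x => algtens_mul (algtens_mul x y) z)) x => [s t|s t|a c].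
- exact: algtens_mulDl.
- by rewrite !algtens_mulDl.
apply: (tensor_ext (f := fun y => algtens_mul (pr a c) (algtens_mul y z))
  (g := fun y => algtens_mul (algtens_mul (pr a c) y) z)) y => [s t|s t|a' c'].
- by rewrite algtens_mulDl algtens_mulDr.
- by rewrite algtens_mulDr algtens_mulDl.
apply: (tensor_ext (f := fun z => algtens_mul (pr a c) (algtens_mul (pr a' c') z))
  (g := algtens_mul (algtens_mul (pr a c) (pr a' c')))) z => [s t|s t|b d].
- by rewrite !algtens_mulDr.
- by rewrite algtens_mulDr.
by rewrite !algtens_mulE !mulrA.
Qed.

Lemma algtens_mul1 : left_id (pr 1 1) algtens_mul.
Proof.
move=> x; apply: (tensor_ext (f := algtens_mul (pr 1 1)) (g := id)) x => //.
  exact: algtens_mulDr.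
by move=> a c; rewrite algtens_mulE !mul1r.
Qed.

(* The image of m^n (x) K in F (x) K, where m is the maximal ideal of F.     *)
Definition fil (n : int) (x : algtens) : Prop :=
  exists2 s : seq (F * K), all (fun p => vpow v n p.1) s & x = tpi _ _ s.

Lemma fil0 n : fil n 0. Proof. by exists [::]. Qed.

Lemma filD n x y : fil n x -> fil n y -> fil n (x + y).
Proof.
move=> [s hs ->] [t ht ->]; exists (s ++ t); first by rewrite all_cat hs ht.
by rewrite tpi_cat.
Qed.

Lemma filN n x : fil n x -> fil n (- x).
Proof.
move=> [s hs ->]; exists [seq (- p.1, p.2) | p <- s]; last exact: tpi_opp.
rewrite all_map; apply: sub_all hs => p /=; exact: vpowN.
Qed.

Lemma filB n x y : fil n x -> fil n y -> fil n (x - y).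
Proof. by move=> hx hy; apply: filD => //; apply: filN. Qed.

Lemma fil_leq m n x : m <= n -> fil n x -> fil m x.
Proof.
move=> mn [s hs ->]; exists s => //; apply: sub_all hs => p; exact: vpow_leq.
Qed.

Lemma fil_pure n a c : vpow v n a -> fil n (pr a c).
Proof. by move=> ha; exists [:: (a, c)] => //=; rewrite ha. Qed.

Lemma fil_ind n (P : algtens -> Prop) : P 0 ->
  (forall a c x, vpow v n a -> P x -> P (pr a c + x)) ->
  forall x, fil n x -> P x.
Proof.
move=> P0 PS x [s hs ->]; elim: s hs => [_|p s IHs /= /andP[hp hs]] //.
by rewrite tpi_cons; apply: PS => //; apply: IHs.
Qed.

Lemma filM m n x y : fil m x -> fil n y -> fil (m + n) (algtens_mul x y).
Proof.
move=> hx hy; elim/fil_ind: hx => [|a c {}x ha IHx].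
  rewrite -(subrr (pr 1 1)) algtens_mulC algtens_mulDr -mulrN1z.
  have -> : algtens_mul y (- pr 1 1) = - algtens_mul y (pr 1 1).
    apply: (@addrI _ (algtens_mul y (pr 1 1))); rewrite -algtens_mulDr !subrr.
    by apply: (@addrI _ (algtens_mul y 0)); rewrite -algtens_mulDr !addr0.
  by rewrite subrr; exact: fil0.
rewrite algtens_mulDl; apply: filD => //.
elim/fil_ind: hy {IHx} => [|a' c' {}y ha' IHy].
  have -> : algtens_mul (pr a c) 0 = 0.
    by apply: (@addrI _ (algtens_mul (pr a c) 0)); rewrite -algtens_mulDr !addr0.
  exact: fil0.
rewrite algtens_mulDr; apply: filD => //.
by rewrite algtens_mulE; apply: fil_pure; apply: vpowM.
Qed.

Lemma fil_ex x : exists n, fil n x.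
Proof.
elim/tensor_ind: x => [|a b x [n hx]]; first by exists 0; exact: fil0.
have [m ha] := vpow_ex a.
exists (Num.min m n); apply: filD.
  by apply: (@fil_leq _ m); rewrite ?ge_min ?lexx //; exact: fil_pure.
by apply: (@fil_leq _ n) hx; rewrite ge_min lexx orbT.
Qed.

Lemma fil_1 : ~ fil 1 (pr 1 1).
Proof.
have [lam [lamD lamZ lam1 lamm]] := lf_functional F.
pose b (a : F) (c : K) := j (lam a) * c.
have hb : balanced FK_ra FK_la b.
  split=> [x y z|x y z|x r y]; rewrite /b ?mulrDr ?lamD ?rmorphD ?mulrDl //.
  by rewrite /FK_ra [x * _]mulrC lamZ [r * _]mulrC rmorphM /FK_la mulrA.
move=> h; have : tlift b (pr 1 1) = 0.
  elim/fil_ind: h => [|a c x ha IHx]; first exact: tlift0.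
  by rewrite (tliftD hb) IHx addr0 tlift_pure // /b lamm // rmorph0 mul0r.
by rewrite tlift_pure // /b lam1 rmorph1 mulr1 => /eqP; rewrite oner_eq0.
Qed.

Lemma algtens_nz : pr 1 1 != 0.
Proof. by apply/eqP => h; apply: fil_1; rewrite h; exact: fil0. Qed.

HB.instance Definition _ := GRing.Zmodule_isComNzRing.Build algtens
  algtens_mulA algtens_mulC algtens_mul1 algtens_mulDl algtens_nz.

Lemma algtens_mulE' a c a' c' : pr a c * pr a' c' = pr (a * a') (c * c').
Proof. exact: algtens_mulE. Qed.

Lemma algtens_1E : 1 = pr 1 1. Proof. by []. Qed.

Lemma fil_mulr m n x y : fil m x -> fil n y -> fil (m + n) (x * y).
Proof. exact: filM. Qed.

Definition is_cauchy : pred (nat -> algtens) := fun u =>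
  `[< forall n : int, exists N, forall i i', (N <= i)%N -> (N <= i')%N ->
        fil n (u i - u i') >].

Definition is_null : pred (nat -> algtens) := fun u =>
  `[< forall n : int, exists N, forall i, (N <= i)%N -> fil n (u i) >].

Lemma cauchy_bounded u : u \in is_cauchy ->
  exists n N, forall i, (N <= i)%N -> fil n (u i).
Proof.
move=> /asboolP/(_ 0)[N hN]; have [n hn] := fil_ex (u N).
exists (Num.min n 0), N => i hi; rewrite -(subrK (u N) (u i)); apply: filD.
  by apply: (@fil_leq _ 0); rewrite ?ge_min ?lexx ?orbT //; exact: hN.
by apply: fil_leq hn; rewrite ge_min lexx.
Qed.

Lemma is_cauchy_subring : subring_closed is_cauchy.
Proof.
split.
- apply/asboolP => n; exists 0%N => i i' _ _; rewrite subrr; exact: fil0.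
- move=> u w /asboolP hu /asboolP hw; apply/asboolP => n.
  have [N hN] := hu n; have [N' hN'] := hw n.
  exists (maxn N N') => i i'; rewrite !geq_max => /andP[i1 i2] /andP[i3 i4].
  have -> : (u - w) i - (u - w) i' = (u i - u i') - (w i - w i').
    by rewrite /= opprD !opprK addrACA opprD opprK.
  by apply: filB; [exact: hN|exact: hN'].
- move=> u w hu hw.
  have [m [Nu bu]] := cauchy_bounded hu; have [m' [Nw bw]] := cauchy_bounded hw.
  apply/asboolP => n.
  move/asboolP: hu => /(_ (n - m'))[N hN]; move/asboolP: hw => /(_ (n - m))[N' hN'].
  exists (maxn (maxn N N') (maxn Nu Nw)) => i i'; rewrite !geq_max.
  move=> /andP[/andP[i1 i2] /andP[i3 i4]] /andP[/andP[k1 k2] /andP[k3 k4]].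
  have -> : (u * w) i - (u * w) i' = u i * (w i - w i') + (u i - u i') * w i'.
    by rewrite mulrBr mulrBl addrA subrK.
  apply: filD; first by rewrite -(subrKC m n) ; apply: fil_mulr; [exact: bu|exact: hN'].
  by rewrite -(subrK m' n); apply: fil_mulr; [exact: hN|exact: bw].
Qed.

HB.instance Definition _ :=
  GRing.isSubringClosed.Build (nat -> algtens) is_cauchy is_cauchy_subring.

Record cauchy_seq := CauchySeq {
  cs_val :> nat -> algtens;
  cs_valP : cs_val \in is_cauchy }.
HB.instance Definition _ := [isSub for cs_val].
HB.instance Definition _ := [Choice of cauchy_seq by <:].
HB.instance Definition _ := [SubChoice_isSubComNzRing of cauchy_seq by <:].

Lemma csB (u w : cauchy_seq) i : (u - w) i = u i - w i. Proof. by []. Qed.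
Lemma csM (u w : cauchy_seq) i : (u * w) i = u i * w i. Proof. by []. Qed.
Lemma cs1 i : (1 : cauchy_seq) i = 1. Proof. by []. Qed.

Definition null_seq : pred cauchy_seq := fun u => is_null (cs_val u).

Lemma null_seq_ideal : idealr_closed null_seq.
Proof.
split.
- by apply/asboolP => n; exists 0%N => i _; exact: fil0.
- apply/asboolP => /(_ 1)[N hN]; apply: fil_1; exact: (hN N).
- move=> a x y /asboolP hx /asboolP hy; apply/asboolP => n.
  have [m [Na ba]] := cauchy_bounded (cs_valP a).
  have [N hN] := hx (n - m); have [N' hN'] := hy n.
  exists (maxn Na (maxn N N')) => i; rewrite !geq_max => /andP[i1 /andP[i2 i3]].
  have -> : cs_val (a * x + y) i = a i * x i + y i by [].
  apply: filD; last exact: hN'.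
  by rewrite -(subrKC m n); apply: fil_mulr; [exact: ba|exact: hN].
Qed.

HB.instance Definition _ := isIdealr.Build cauchy_seq null_seq null_seq_ideal.
Definition null_ideal : idealr cauchy_seq := null_seq.

(* The completion of F (x) K for the topology given by the m^n (x) K, that is,
   the completed tensor product of F and the discrete field K over Fq.       *)
Definition ctens : Type := {ideal_quot null_ideal}.
HB.instance Definition _ := GRing.ComNzRing.on ctens.

Definition ctens_pi (u : cauchy_seq) : ctens := \pi_({ideal_quot null_ideal}) u.

Lemma ctens_pi_is_zmod : zmod_morphism ctens_pi.
Proof. exact: (@pi_is_zmod_morphism _ _ _ {ideal_quot null_ideal}). Qed.
HB.instance Definition _ :=
  GRing.isZmodMorphism.Build cauchy_seq ctens ctens_pi ctens_pi_is_zmod.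
Lemma ctens_pi_is_monoid : monoid_morphism ctens_pi.
Proof. exact: (@pi_is_monoid_morphism _ _ _ {ideal_quot null_ideal}). Qed.
HB.instance Definition _ :=
  GRing.isMonoidMorphism.Build cauchy_seq ctens ctens_pi ctens_pi_is_monoid.

Definition ctens_repr (x : ctens) : cauchy_seq := repr (x : {ideal_quot null_ideal}).

Lemma ctens_reprK : cancel ctens_repr ctens_pi.
Proof. by move=> x; rewrite /ctens_pi /ctens_repr reprK. Qed.

Lemma ctens_piP u w : ctens_pi u = ctens_pi w <-> null_seq (u - w).
Proof. by split=> [/eqmodP|?]; [|apply/eqmodP]. Qed.

Lemma const_cauchy x : (fun _ => x) \in is_cauchy.
Proof.
by apply/asboolP => n; exists 0%N => i i' _ _; rewrite subrr; exact: fil0.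
Qed.

Definition cpure (a : F) (c : K) : ctens :=
  ctens_pi (CauchySeq (const_cauchy (pr a c))).

End AlgTensor.

Arguments cpure {Fq F K j} a c.

Section Functoriality.
Variables (Fq : finFieldType) (F : localField Fq).

Section Map.
Variables (K K' : fieldType) (j : {rmorphism Fq -> K}).
Variables (j' : {rmorphism Fq -> K'}) (g : {rmorphism K -> K'}).
Hypothesis gj : forall c, g (j c) = j' c.
Local Notation A := (algtens F j).
Local Notation A' := (algtens F j').

Definition algtens_map (x : A) : A' := tlift (fun a c => pure a (g c)) x.

Lemma algtens_map_bal :
  balanced (@FK_ra Fq F) (FK_la j) (fun a c => pure a (g c) : A').
Proof.
split=> [x y z|x y z|x r y]; rewrite ?rmorphD ?pureDl ?pureDr //.
by rewrite pureM /FK_la rmorphM gj.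
Qed.

Lemma algtens_mapE a c : algtens_map (pure a c) = pure a (g c).
Proof. exact: (tlift_pure _ _ algtens_map_bal). Qed.

Lemma algtens_mapD : {morph algtens_map : x y / x + y}.
Proof. exact: (tliftD algtens_map_bal). Qed.

Lemma algtens_map_is_zmod : zmod_morphism algtens_map.
Proof.
move=> x y; apply: (@addIr _ (algtens_map y)).
by rewrite -algtens_mapD !subrK.
Qed.
HB.instance Definition _ :=
  GRing.isZmodMorphism.Build A A' algtens_map algtens_map_is_zmod.

Lemma algtens_map_is_monoid : monoid_morphism algtens_map.
Proof.
split; first by rewrite algtens_1E algtens_mapE rmorph1.
move=> x y; apply: (tensor_ext (f := fun x => algtens_map ((x : A) * y))
  (g := fun x => algtens_map x * algtens_map y)) x => [s t|s t|a c].
- by rewrite mulrDl raddfD.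
- by rewrite raddfD mulrDl.
apply: (tensor_ext (f := fun y => algtens_map ((pure a c : A) * y))
  (g := fun y => algtens_map (pure a c) * algtens_map y)) y => [s t|s t|a' c'].
- by rewrite mulrDr raddfD.
- by rewrite raddfD mulrDr.
by rewrite !(algtens_mapE, algtens_mulE') rmorphM.
Qed.
HB.instance Definition _ :=
  GRing.isMonoidMorphism.Build A A' algtens_map algtens_map_is_monoid.

Lemma algtens_map_fil n x : fil n x -> fil n (algtens_map x).
Proof.
elim/fil_ind => [|a c {}x ha hx]; first by rewrite raddf0; exact: fil0.
by rewrite raddfD; apply: filD => //; rewrite /= algtens_mapE; exact: fil_pure.
Qed.

Lemma cs_map_subproof (u : cauchy_seq F j) :
  (fun i => algtens_map (u i)) \in @is_cauchy Fq F K' j'.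
Proof.
apply/asboolP => n; case/asboolP/(_ n): (cs_valP u) => N hN.
exists N => i i' hi hi'; rewrite -raddfB; apply: algtens_map_fil; exact: hN.
Qed.
Definition cs_map (u : cauchy_seq F j) : cauchy_seq F j' :=
  CauchySeq (cs_map_subproof u).

Lemma cs_mapE u i : cs_map u i = algtens_map (u i). Proof. by []. Qed.

Lemma cs_ext (u w : cauchy_seq F j') : (forall i, u i = w i) -> u = w.
Proof. by move=> uw; apply/val_inj/funext. Qed.

Definition ctens_map (x : ctens F j) : ctens F j' :=
  ctens_pi (cs_map (ctens_repr x)).

Lemma ctens_map_pi (u : cauchy_seq F j) :
  ctens_map (ctens_pi u) = ctens_pi (cs_map u).
Proof.
apply/ctens_piP; set w := ctens_repr _.
have /ctens_piP/asboolP H : ctens_pi w = ctens_pi u by rewrite ctens_reprK.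
apply/asboolP => n; have [N hN] := H n; exists N => i hi.
have -> : cs_val (cs_map w - cs_map u) i = algtens_map ((w - u) i).
  by rewrite raddfB.
by apply: algtens_map_fil; exact: hN.
Qed.

Lemma ctens_map_is_zmod : zmod_morphism ctens_map.
Proof.
move=> x y; rewrite -[x]ctens_reprK -[y]ctens_reprK -raddfB !ctens_map_pi.
rewrite -raddfB; congr ctens_pi; apply: cs_ext => i.
by rewrite csB !cs_mapE csB raddfB.
Qed.
HB.instance Definition _ :=
  GRing.isZmodMorphism.Build (ctens F j) (ctens F j') ctens_map ctens_map_is_zmod.

Lemma ctens_map_is_monoid : monoid_morphism ctens_map.
Proof.
split=> [|x y].
  rewrite -(rmorph1 (@ctens_pi _ F K j)) ctens_map_pi.
  rewrite -(rmorph1 (@ctens_pi _ F K' j')).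
  congr ctens_pi; apply: cs_ext => i.
  by rewrite cs_mapE !cs1 rmorph1.
rewrite -[x]ctens_reprK -[y]ctens_reprK -rmorphM !ctens_map_pi.
rewrite -rmorphM; congr ctens_pi; apply: cs_ext => i.
by rewrite csM !cs_mapE csM rmorphM.
Qed.
HB.instance Definition _ :=
  GRing.isMonoidMorphism.Build (ctens F j) (ctens F j') ctens_map ctens_map_is_monoid.

Lemma ctens_map_pure a c : ctens_map (cpure a c) = cpure a (g c).
Proof.
rewrite ctens_map_pi; congr ctens_pi; apply/val_inj/funext => i /=.
by rewrite algtens_mapE.
Qed.

End Map.

Lemma ctens_map_id (K : fieldType) (j : {rmorphism Fq -> K})
    (g : {rmorphism K -> K}) (gj : forall c, g (j c) = j c) :
  g =1 id -> ctens_map gj =1 id.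
Proof.
move=> gid x; rewrite -[x]ctens_reprK ctens_map_pi; congr ctens_pi.
apply: cs_ext => i; rewrite cs_mapE.
have H : algtens_map j g =1 (id : algtens F j -> algtens F j).
  apply: tensor_ext => // [|a b]; first exact: algtens_mapD.
  by rewrite algtens_mapE // gid.
exact: H.
Qed.

Lemma ctens_map_comp (K1 K2 K3 : fieldType) (j1 : {rmorphism Fq -> K1})
    (j2 : {rmorphism Fq -> K2}) (j3 : {rmorphism Fq -> K3})
    (g : {rmorphism K1 -> K2}) (h : {rmorphism K2 -> K3})
    (f : {rmorphism K1 -> K3}) (gj : forall c, g (j1 c) = j2 c)
    (hj : forall c, h (j2 c) = j3 c) (fj : forall c, f (j1 c) = j3 c) :
  (forall x, h (g x) = f x) ->
  forall x, ctens_map hj (ctens_map gj x) = ctens_map fj x.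
Proof.
move=> hg x; rewrite -[x]ctens_reprK !ctens_map_pi; congr ctens_pi.
apply: cs_ext => i; rewrite !cs_mapE.
have H : (fun y => algtens_map j3 h (algtens_map j2 g y))
    =1 (algtens_map j3 f : algtens F j1 -> algtens F j3).
  apply: tensor_ext => [s t|s t|a b].
  - by rewrite (algtens_mapD gj) (algtens_mapD hj).
  - exact: algtens_mapD.
  - by rewrite (algtens_mapE gj) (algtens_mapE hj) (algtens_mapE fj) hg.
exact: H.
Qed.

End Functoriality.

Section Frobenius.
Variables (Fq : finFieldType) (K : fieldType) (j : {rmorphism Fq -> K}).

(* The embedding j only serves to make this map a ring endomorphism.         *)
Definition frob of {rmorphism Fq -> K} := fun x : K => x ^+ #|Fq|.

Lemma frob_is_zmod : zmod_morphism (frob j).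
Proof.
have [p _ pchFq] := finPcharP Fq.
have pchK : p \in [pchar K] by rewrite (fmorph_pchar j).
rewrite /frob (card_pprimeChar pchFq) => x y.
elim: (logn _ _) => [|m IHm]; first by rewrite !expr1.
by rewrite expnSr !exprM IHm -!(pFrobenius_autE pchK) rmorphB.
Qed.
HB.instance Definition _ := GRing.isZmodMorphism.Build K K (frob j) frob_is_zmod.

Lemma frob_is_monoid : monoid_morphism (frob j).
Proof. by split=> [|x y]; rewrite /frob ?expr1n ?exprMn. Qed.
HB.instance Definition _ :=
  GRing.isMonoidMorphism.Build K K (frob j) frob_is_monoid.

Lemma frob_fix c : frob j (j c) = j c.
Proof. by rewrite /frob -rmorphXn expf_card. Qed.

End Frobenius.

Definition sigma (Fq : finFieldType) (F : localField Fq) (K : fieldType)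
    (j : {rmorphism Fq -> K}) : {rmorphism ctens F j -> ctens F j} :=
  ctens_map (F := F) (frob_fix j).

Lemma sigma_pure (Fq : finFieldType) (F : localField Fq) (K : fieldType)
    (j : {rmorphism Fq -> K}) (a : F) (c : K) :
  sigma F j (cpure a c) = cpure a (c ^+ #|Fq|).
Proof. exact: ctens_map_pure. Qed.

Definition zpow (T : Type) (f g : T -> T) (m : int) : T -> T :=
  match m with Posz n => iter n f | Negz n => iter n.+1 g end.

Section ZPow.
Variables (T : Type) (f g : T -> T).
Hypotheses (fK : cancel f g) (gK : cancel g f).

Lemma zpowVK m : cancel (zpow f g m) (zpow f g (- m)).
Proof.
case: m => [[|n]|n] x //=; rewrite -!iterS.
  by elim: n x => [|n IHn] x; rewrite ?fK // iterSr [iter n.+2 f x]iterS fK IHn.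
by elim: n x => [|n IHn] x; rewrite ?gK // iterSr [iter n.+2 g x]iterS gK IHn.
Qed.
End ZPow.

Section ClosedFrobenius.
Variables (Fq : finFieldType) (L : closedFieldType) (j : {rmorphism Fq -> L}).

Lemma frob_surj y : exists x, frob j x = y.
Proof.
have q0 : (0 < #|Fq|)%N by apply/card_gt0P; exists 0.
have [x hx] := solve_monicpoly (fun i => if i == 0%N then y else 0) q0.
exists x; rewrite /frob hx; case: #|Fq| q0 => // n _.
by rewrite big_ord_recl /= expr0 mulr1 big1 ?addr0 // => i _; rewrite mul0r.
Qed.

Definition frobV (y : L) : L := projT1 (cid (frob_surj y)).

Lemma frob_inj : injective (frob j).
Proof. exact: fmorph_inj. Qed.

Lemma frobVK : cancel frobV (frob j).
Proof. by move=> y; rewrite /frobV; case: cid. Qed.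
Lemma frobK : cancel (frob j) frobV.
Proof. by move=> y; apply: frob_inj; rewrite frobVK. Qed.

Lemma frobV_is_zmod : zmod_morphism frobV.
Proof.
move=> x y; apply: frob_inj.
by rewrite frobVK rmorphB /= !frobVK.
Qed.
HB.instance Definition _ := GRing.isZmodMorphism.Build L L frobV frobV_is_zmod.
Lemma frobV_is_monoid : monoid_morphism frobV.
Proof.
split=> [|x y]; apply: frob_inj; first by rewrite frobVK rmorph1.
by rewrite frobVK rmorphM /= !frobVK.
Qed.
HB.instance Definition _ :=
  GRing.isMonoidMorphism.Build L L frobV frobV_is_monoid.

Lemma frobV_fix c : frobV (j c) = j c.
Proof. by rewrite -{1}(frob_fix j c) frobK. Qed.

End ClosedFrobenius.

Fixpoint riter (K : fieldType) n (g : {rmorphism K -> K}) : {rmorphism K -> K} :=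
  if n is m.+1 then g \o riter m g else idfun.

Lemma riterE (K : fieldType) n (g : {rmorphism K -> K}) : riter n g =1 iter n g.
Proof. by elim: n => //= n IHn x /=; rewrite IHn. Qed.

(* Frob^m for m in Z                                                         *)
Definition frobz (Fq : finFieldType) (L : closedFieldType)
    (j : {rmorphism Fq -> L}) (m : int) : {rmorphism L -> L} :=
  match m with Posz n => riter n (frob j) | Negz n => riter n.+1 (frobV j) end.

Lemma frobzE (Fq : finFieldType) (L : closedFieldType)
  (j : {rmorphism Fq -> L}) m : frobz j m =1 zpow (frob j) (frobV j) m.
Proof. by case: m => n x; exact: riterE. Qed.

Record summand (E : comNzRingType) (M : lmodType E) := Summand {
  sm_n : nat;
  sm_inj : {linear M -> 'rV[E]_sm_n};
  sm_proj : {linear 'rV[E]_sm_n -> M};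
  sm_K : cancel sm_inj sm_proj }.

Definition fg_projective (E : comNzRingType) (M : lmodType E) : Prop :=
  exists D : summand M, True.

Section Charpoly.
Variables (E : comNzRingType) (M : lmodType E).
Implicit Types (D : summand M) (f : M -> M).

Definition summand_mx D D' f : 'M[E]_(sm_n D, sm_n D') :=
  lin1_mx (sm_inj D' \o f \o sm_proj D).

(* If M (+) N = E^n, the determinant of X.id - f on M[X] is that of the
   endomorphism of E[X]^n which is X.id - f on M[X] and the identity on N[X].
   Its matrix is X.e - A + (1 - e), where e and A are the matrices of the
   projection to M and of f extended by 0 on N.  When M is free this is the
   usual characteristic polynomial, see [charpoly_free].                     *)
Definition charpoly_of D f : {poly E} :=
  let e := map_mx polyC (summand_mx D D id) in
  \det ('X *: e - map_mx polyC (summand_mx D D f) + (1%:M - e)).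

Definition charpoly f : {poly E} :=
  if pselect (fg_projective M) is left h then charpoly_of (projT1 (cid h)) f
  else 0.

Lemma summand_mx_comp D D' D'' (f g : {linear M -> M}) :
  summand_mx D D' f *m summand_mx D' D'' g = summand_mx D D'' (g \o f).
Proof.
apply/row_matrixP => i; rewrite row_mul [in RHS]rowE mul_rV_lin1 /=.
rewrite [row i _]rowE mul_rV_lin1 mul_rV_lin1 /=.
by rewrite sm_K.
Qed.

Lemma det_1addC (R : comNzRingType) m n (U : 'M[R]_(m, n)) (V : 'M[R]_(n, m)) :
  \det (1%:M + U *m V) = \det (1%:M + V *m U).
Proof.
pose B := block_mx 1%:M (- U) V 1%:M; pose T := block_mx 1%:M U 0 1%:M.
have detT : \det T = 1 by rewrite det_ublock !det1 mulr1.
have : \det (T *m B) = \det (B *m T) by rewrite !det_mulmx mulrC.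
rewrite /T /B !mulmx_block !(mul1mx, mulmx1, mul0mx, mulmx0, add0r, addr0).
rewrite addNr subrr det_lblock det_lblock !det1 mul1r mulr1 => ->.
by rewrite addrC.
Qed.

Lemma charpoly_of_indep D D' (f : {linear M -> M}) :
  charpoly_of D f = charpoly_of D' f.
Proof.
pose P D1 D2 h := map_mx (@polyC E) (summand_mx D1 D2 h).
have PM D1 D2 D3 (h k : {linear M -> M}) : P D1 D2 h *m P D2 D3 k = P D1 D3 (k \o h).
  by rewrite -map_mxM summand_mx_comp.
have toV D1 D2 : P D1 D2 idfun *m ('X *: P D2 D1 idfun - P D2 D1 f - P D2 D1 idfun)
   = 'X *: P D1 D1 idfun - P D1 D1 f - P D1 D1 idfun.
  by rewrite !mulmxBr -scalemxAr !PM.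
have toV' D1 D2 : ('X *: P D2 D1 idfun - P D2 D1 f - P D2 D1 idfun) *m P D1 D2 idfun
   = 'X *: P D2 D2 idfun - P D2 D2 f - P D2 D2 idfun.
  by rewrite !mulmxBl -scalemxAl !PM.
have cE D1 : charpoly_of D1 f =
    \det (1%:M + ('X *: P D1 D1 idfun - P D1 D1 f - P D1 D1 idfun)).
  by rewrite /charpoly_of /= -/(P D1 D1 _) -/(P D1 D1 _) addrCA addrA.
by rewrite !cE -(toV D D') det_1addC toV'.
Qed.

Lemma charpolyE D (f : {linear M -> M}) : charpoly f = charpoly_of D f.
Proof.
rewrite /charpoly; case: pselect => [h|[]]; first exact: charpoly_of_indep.
by exists D.
Qed.

Lemma charpoly_free D (f : {linear M -> M}) :
  cancel (sm_proj D) (sm_inj D) -> charpoly f = char_poly (summand_mx D D f).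
Proof.
move=> DK; rewrite (charpolyE D) /charpoly_of /=.
have -> : summand_mx D D id = 1%:M.
  apply/row_matrixP => i; rewrite !rowE.
  by rewrite (mul_rV_lin1 (sm_inj D \o sm_proj D)) mulmx1 /= DK.
by rewrite map_mx1 subrr addr0 scalemx1.
Qed.

End Charpoly.

Section BaseChange.
Variables (E E' : comNzRingType) (g : {rmorphism E -> E'}) (M : lmodType E).

(* E' (x)_{E,g} M, with E' acting on the left factor.                        *)
Definition bc_ra (e : E') (a : E) : E' := e * g a.
Definition bc_la (a : E) (m : M) : M := a *: m.
Definition bctens : Type := tensor bc_ra bc_la.
HB.instance Definition _ := GRing.Zmodule.on bctens.

Definition bc_pure (e : E') (m : M) : bctens := pure e m.
Definition bc_scale (e : E') (x : bctens) : bctens :=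
  tlift (fun e' m => bc_pure (e * e') m) x.

Lemma bc_pure_bal : balanced bc_ra bc_la bc_pure.
Proof. exact: pure_balanced. Qed.

Lemma bc_scale_bal e : balanced bc_ra bc_la (fun e' m => bc_pure (e * e') m).
Proof.
split=> [x y z|x y z|x r y].
- by rewrite mulrDr (balDl bc_pure_bal).
- by rewrite (balDr bc_pure_bal).
- by rewrite /bc_ra mulrA (balM bc_pure_bal).
Qed.

Lemma bc_scaleD e : {morph bc_scale e : x y / x + y}.
Proof. exact: tliftD (bc_scale_bal e). Qed.

Lemma bc_scaleE e e' m : bc_scale e (bc_pure e' m) = bc_pure (e * e') m.
Proof. exact: tlift_pure (bc_scale_bal e). Qed.

Lemma bc_ext (G : zmodType) (f h : bctens -> G) :
  {morph f : x y / x + y} -> {morph h : x y / x + y} ->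
  (forall e m, f (bc_pure e m) = h (bc_pure e m)) -> f =1 h.
Proof. exact: tensor_ext. Qed.

Lemma bc_scaleA a b x : bc_scale a (bc_scale b x) = bc_scale (a * b) x.
Proof.
apply: (bc_ext (f := fun x => bc_scale a (bc_scale b x))
  (h := bc_scale (a * b))) x => [s t|s t|e m].
- by rewrite !bc_scaleD.
- exact: bc_scaleD.
- by rewrite !bc_scaleE mulrA.
Qed.

Lemma bc_scale1 : left_id 1 bc_scale.
Proof.
apply: (bc_ext (f := bc_scale 1) (h := id)) => // [|e m]; first exact: bc_scaleD.
by rewrite bc_scaleE mul1r.
Qed.

Lemma bc_scaleDl x : {morph bc_scale^~ x : a b / a + b}.
Proof.
move=> a b; apply: (bc_ext (f := bc_scale (a + b))
  (h := fun x => bc_scale a x + bc_scale b x)) x => [|s t|e m].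
- exact: bc_scaleD.
- by rewrite !bc_scaleD addrACA.
- by rewrite !bc_scaleE mulrDl (balDl bc_pure_bal).
Qed.

HB.instance Definition _ := GRing.Zmodule_isLmodule.Build E' bctens
  bc_scaleA bc_scale1 bc_scaleD bc_scaleDl.

Lemma bc_scale_pure e e' m : e *: bc_pure e' m = bc_pure (e * e') m.
Proof. exact: bc_scaleE. Qed.

End BaseChange.

Record taumod (E : comNzRingType) (s : E -> E) := TauMod {
  tm_sort :> lmodType E;
  tau : tm_sort -> tm_sort;
  tauD : forall x y, tau (x + y) = tau x + tau y;
  tauZ : forall e x, tau (e *: x) = s e *: tau x }.
Arguments tau {E s} t.

Section TauMod.
Variables (E : comNzRingType) (s : {rmorphism E -> E}) (M : taumod s).

(* sigma^* M -> M                                                            *)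
Definition linearization : bctens s M -> M :=
  tlift (fun e m => e *: tau M m).

Lemma linearization_bal :
  balanced (bc_ra s) (@bc_la E M) (fun e m => e *: tau M m).
Proof.
split=> [x y z|x y z|x r y]; first exact: scalerDl.
  by rewrite tauD scalerDr.
by rewrite /bc_la tauZ scalerA.
Qed.

Lemma linearizationE e m : linearization (bc_pure s e m) = e *: tau M m.
Proof. exact: tlift_pure linearization_bal. Qed.

Lemma tau0 : tau M 0 = 0.
Proof. by apply: (@addrI _ (tau M 0)); rewrite -tauD !addr0. Qed.

(* A semilinear map whose linearization is bijective is itself bijective as
   soon as the underlying ring endomorphism is.                              *)
Lemma tau_bij (si : {rmorphism E -> E}) : cancel s si -> cancel si s ->
  bijective linearization -> exists g, cancel (tau M) g /\ cancel g (tau M).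
Proof.
move=> sK siK [h lK hK].
have si_bal : balanced (bc_ra s) (@bc_la E M) (fun e m => si e *: m).
  split=> [x y z|x y z|x r y]; first by rewrite rmorphD scalerDl.
    exact: scalerDr.
  by rewrite /bc_ra rmorphM sK -scalerA.
pose d : bctens s M -> M := tlift (fun e m => si e *: m).
have dE e m : d (bc_pure s e m) = si e *: m by exact: tlift_pure si_bal.
have dK x : bc_pure s 1 (d x) = x.
  apply: (bc_ext (f := fun x => bc_pure s 1 (d x)) (h := id)) x => // [x y|e m].
    by rewrite /d (tliftD si_bal) (balDr (bc_pure_bal s M)).
  by rewrite dE -/(bc_la (si e) m) -(balM (bc_pure_bal s M)) /bc_ra siK mul1r.
exists (d \o h); split=> m /=.
  by rewrite -[tau M m]scale1r -linearizationE lK dE rmorph1 scale1r.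
by rewrite -[tau M _]scale1r -linearizationE dK hK.
Qed.

End TauMod.

Section TauBaseChange.
Variables (E E' : comNzRingType) (s : {rmorphism E -> E}).
Variables (s' : {rmorphism E' -> E'}) (g : {rmorphism E -> E'}).
Hypothesis gs : forall e, s' (g e) = g (s e).
Variable M : taumod s.

Definition bc_map (t : E' -> E') (h : M -> M) : bctens g M -> bctens g M :=
  tlift (fun e m => bc_pure g (t e) (h m)).

Lemma bc_map_bal (t : {rmorphism E' -> E'}) (r : E -> E) (h : M -> M) :
  (forall e, t (g e) = g (r e)) ->
  (forall x y, h (x + y) = h x + h y) -> (forall e x, h (e *: x) = r e *: h x) ->
  balanced (bc_ra g) (@bc_la E M) (fun e m => bc_pure g (t e) (h m)).
Proof.
move=> tg hD hZ; split=> [x y z|x y z|x a y].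
- by rewrite rmorphD (balDl (bc_pure_bal g M)).
- by rewrite hD (balDr (bc_pure_bal g M)).
- by rewrite /bc_ra /bc_la rmorphM hZ tg (balM (bc_pure_bal g M)).
Qed.

Section BcMap.
Variables (t : {rmorphism E' -> E'}) (r : E -> E) (h : M -> M).
Hypotheses (tg : forall e, t (g e) = g (r e))
  (hD : forall x y, h (x + y) = h x + h y)
  (hZ : forall e x, h (e *: x) = r e *: h x).

Lemma bc_mapE e m : bc_map t h (bc_pure g e m) = bc_pure g (t e) (h m).
Proof. exact: tlift_pure (bc_map_bal tg hD hZ). Qed.

Lemma bc_mapD : {morph bc_map t h : x y / x + y}.
Proof. exact: tliftD (bc_map_bal tg hD hZ). Qed.

Lemma bc_mapZ e x : bc_map t h (e *: x) = t e *: bc_map t h x.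
Proof.
apply: (bc_ext (f := fun x => bc_map t h (e *: x))
  (h := fun x => t e *: bc_map t h x)) x => [x y|x y|e' m].
- by rewrite scalerDr bc_mapD.
- by rewrite bc_mapD scalerDr.
- by rewrite bc_scale_pure !bc_mapE bc_scale_pure rmorphM.
Qed.
End BcMap.

Definition bc_taumod : taumod s' :=
  @TauMod E' s' (bctens g M) (bc_map s' (tau M))
    (bc_mapD gs (@tauD E s M) (@tauZ E s M))
    (bc_mapZ gs (@tauD E s M) (@tauZ E s M)).

End TauBaseChange.

Section Hom.
Variables (E : comNzRingType) (s : E -> E).

Record tmhom (P Q : taumod s) := TmHom {
  hom_fun :> P -> Q;
  hom_linear : linear hom_fun;
  hom_tau : forall x, hom_fun (tau P x) = tau Q (hom_fun x) }.

Section HomZmod.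
Variables P Q : taumod s.
Implicit Types f h : tmhom P Q.

Lemma tmhom_ext f h : f =1 h -> f = h.
Proof.
case: f h => [f fl ft] [h hl ht] /= /funext e; subst h.
by congr TmHom; exact: Prop_irrelevance.
Qed.

HB.instance Definition _ := gen_eqMixin (tmhom P Q).
HB.instance Definition _ := gen_choiceMixin (tmhom P Q).

Lemma homD f x y : f (x + y) = f x + f y.
Proof. by have := hom_linear f 1 x y; rewrite !scale1r. Qed.
Lemma hom0 f : f 0 = 0.
Proof. by apply: (@addrI _ (f 0)); rewrite -homD !addr0. Qed.
Lemma homZ f e x : f (e *: x) = e *: f x.
Proof. by have := hom_linear f e x 0; rewrite hom0 !addr0. Qed.

Lemma taumodN x : tau Q (- x) = - tau Q x.
Proof.
have t0 : tau Q 0 = 0 by apply: (@addrI _ (tau Q 0)); rewrite -tauD !addr0.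
by apply: (@addrI _ (tau Q x)); rewrite -tauD !subrr.
Qed.

Definition hom_zero : tmhom P Q.
Proof.
exists (fun=> 0) => [e x y|x]; first by rewrite scaler0 addr0.
by apply: (@addrI _ (tau Q 0)); rewrite -tauD !addr0.
Defined.
Definition hom_add f h : tmhom P Q.
Proof.
exists (fun x => f x + h x) => [e x y|x].
  by rewrite !hom_linear scalerDr addrACA.
by rewrite !hom_tau tauD.
Defined.
Definition hom_opp f : tmhom P Q.
Proof.
exists (fun x => - f x) => [e x y|x].
  by rewrite hom_linear opprD scalerN.
by rewrite hom_tau taumodN.
Defined.

Lemma hom_addA : associative hom_add.
Proof. by move=> f h k; apply: tmhom_ext => x /=; rewrite addrA. Qed.
Lemma hom_addC : commutative hom_add.
Proof. by move=> f h; apply: tmhom_ext => x /=; rewrite addrC. Qed.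
Lemma hom_add0 : left_id hom_zero hom_add.
Proof. by move=> f; apply: tmhom_ext => x /=; rewrite add0r. Qed.
Lemma hom_addN : left_inverse hom_zero hom_opp hom_add.
Proof. by move=> f; apply: tmhom_ext => x /=; rewrite addNr. Qed.

HB.instance Definition _ :=
  GRing.isZmodule.Build (tmhom P Q) hom_addA hom_addC hom_add0 hom_addN.

End HomZmod.

Definition hom_comp (P Q L : taumod s) (f : tmhom Q L) (h : tmhom P Q) :
  tmhom P L.
Proof.
exists (f \o h) => [e x y|x] /=; first by rewrite !hom_linear.
by rewrite !hom_tau.
Defined.

(* Hom(P,Q) (x)_{End P} P with scalars acting on the right factor; the ring
   End(P) acts on Hom(P,Q) from the right by composition.                    *)
Section HomTensor.
Variables P Q : taumod s.

Definition ht_ra (f : tmhom P Q) (e : tmhom P P) : tmhom P Q := hom_comp f e.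
Definition ht_la (e : tmhom P P) (p : P) : P := e p.
Definition homtens : Type := tensor ht_ra ht_la.
HB.instance Definition _ := GRing.Zmodule.on homtens.

Definition ht_pure (f : tmhom P Q) (p : P) : homtens := pure f p.
Definition ht_scale (e : E) (x : homtens) : homtens :=
  tlift (fun f p => ht_pure f (e *: p)) x.

Lemma ht_pure_bal : balanced ht_ra ht_la ht_pure.
Proof. exact: pure_balanced. Qed.

Lemma ht_scale_bal e : balanced ht_ra ht_la (fun f p => ht_pure f (e *: p)).
Proof.
split=> [x y z|x y z|x r y].
- by rewrite (balDl ht_pure_bal).
- by rewrite scalerDr (balDr ht_pure_bal).
- by rewrite (balM ht_pure_bal) /ht_la homZ.
Qed.

Lemma ht_scaleD e : {morph ht_scale e : x y / x + y}.
Proof. exact: tliftD (ht_scale_bal e). Qed.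

Lemma ht_scaleE e f p : ht_scale e (ht_pure f p) = ht_pure f (e *: p).
Proof. exact: tlift_pure (ht_scale_bal e). Qed.

Lemma ht_ext (G : zmodType) (f h : homtens -> G) :
  {morph f : x y / x + y} -> {morph h : x y / x + y} ->
  (forall e m, f (ht_pure e m) = h (ht_pure e m)) -> f =1 h.
Proof. exact: tensor_ext. Qed.

Lemma ht_scaleA a b x : ht_scale a (ht_scale b x) = ht_scale (a * b) x.
Proof.
apply: (ht_ext (f := fun x => ht_scale a (ht_scale b x))
  (h := ht_scale (a * b))) x => [y z|y z|f p].
- by rewrite !ht_scaleD.
- exact: ht_scaleD.
- by rewrite !ht_scaleE scalerA.
Qed.

Lemma ht_scale1 : left_id 1 ht_scale.
Proof.
apply: (ht_ext (f := ht_scale 1) (h := id)) => // [|f p]; first exact: ht_scaleD.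
by rewrite ht_scaleE scale1r.
Qed.

Lemma ht_scaleDl x : {morph ht_scale^~ x : a b / a + b}.
Proof.
move=> a b; apply: (ht_ext (f := ht_scale (a + b))
  (h := fun x => ht_scale a x + ht_scale b x)) x => [|y z|f p].
- exact: ht_scaleD.
- by rewrite !ht_scaleD addrACA.
- by rewrite !ht_scaleE scalerDl (balDr ht_pure_bal).
Qed.

HB.instance Definition _ := GRing.Zmodule_isLmodule.Build E homtens
  ht_scaleA ht_scale1 ht_scaleD ht_scaleDl.

Lemma ht_scale_pure e f p : e *: ht_pure f p = ht_pure f (e *: p).
Proof. exact: ht_scaleE. Qed.

End HomTensor.

Arguments ht_pure {P Q} f p.

Section HomTensorMap.
Variables (P P' Q : taumod s).
Variables (phi : tmhom P Q -> tmhom P' Q) (psi : P -> P').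

Definition ht_map (x : homtens P Q) : homtens P' Q :=
  tlift (fun f p => ht_pure (phi f) (psi p)) x.

Hypothesis phi_psi : balanced (@ht_ra P Q) (@ht_la P)
  (fun f p => ht_pure (phi f) (psi p)).
Hypothesis psiZ : forall e p, psi (e *: p) = e *: psi p.

Lemma ht_mapE f p : ht_map (ht_pure f p) = ht_pure (phi f) (psi p).
Proof. exact: tlift_pure phi_psi. Qed.

Lemma ht_mapD : {morph ht_map : x y / x + y}.
Proof. exact: tliftD phi_psi. Qed.

Lemma ht_map_linear : linear ht_map.
Proof.
move=> e x y; rewrite ht_mapD; congr (_ + _).
apply: (ht_ext (f := fun x => ht_map (e *: x))
  (h := fun x => e *: ht_map x)) x => [u w|u w|f p].
- by rewrite scalerDr ht_mapD.
- by rewrite ht_mapD scalerDr.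
- by rewrite ht_scale_pure !ht_mapE ht_scale_pure psiZ.
Qed.

End HomTensorMap.

(* The transition map h (x) p |-> (h o pi) (x) iota(p).                      *)
Section Transition.
Variables (P P' Q : taumod s) (iota : tmhom P P') (pi : tmhom P' P).
Hypothesis piK : cancel iota pi.

Definition transition : homtens P Q -> homtens P' Q :=
  ht_map (fun h => hom_comp h pi) iota.

Lemma transition_bal : balanced (@ht_ra P Q) (@ht_la P)
  (fun h p => ht_pure (hom_comp h pi) (iota p)).
Proof.
split=> [x y z|x y z|x r y].
- rewrite -(balDl (@ht_pure_bal P' Q)); congr ht_pure.
  by apply: tmhom_ext.
- by rewrite homD (balDr (@ht_pure_bal P' Q)).
- pose r' := hom_comp iota (hom_comp r pi).
  have -> : ht_pure (hom_comp (ht_ra x r) pi) (iota y) =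
            ht_pure (ht_ra (hom_comp x pi) r') (iota y).
    by congr ht_pure; apply: tmhom_ext => z /=; rewrite piK.
  by rewrite (balM (@ht_pure_bal P' Q)) /ht_la /= piK.
Qed.

Lemma transitionE h p :
  transition (ht_pure h p) = ht_pure (hom_comp h pi) (iota p).
Proof. exact: (ht_mapE transition_bal). Qed.

Lemma transition_linear : linear transition.
Proof. by apply: (ht_map_linear transition_bal) => e p; rewrite homZ. Qed.

End Transition.

End Hom.

Arguments ht_pure {E s P Q} f p.
Arguments transition {E s P P'} Q iota pi.

Record isocrystal (Fq : finFieldType) (F : localField Fq) (K : fieldType)
    (j : {rmorphism Fq -> K}) := Isocrystal {
  iso_tm :> taumod (sigma F j);
  iso_fgp : fg_projective iso_tm;
  iso_lin : bijective (@linearization _ (sigma F j) iso_tm) }.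

Section OverClosedField.
Variables (Fq : finFieldType) (F : localField Fq) (L : closedFieldType).
Variable j : {rmorphism Fq -> L}.
Local Notation E := (ctens F j).
Local Notation sg := (sigma F j).

Definition sigmaV : {rmorphism E -> E} := ctens_map (F := F) (frobV_fix j).

Lemma sigmaK : cancel sg sigmaV.
Proof.
move=> x.
have H : forall c, (idfun : {rmorphism L -> L}) (j c) = j c by [].
rewrite /sigmaV /sigma /= (ctens_map_comp _ _ H) ?ctens_map_id //; exact: frobK.
Qed.

Lemma sigmaVK : cancel sigmaV sg.
Proof.
move=> x.
have H : forall c, (idfun : {rmorphism L -> L}) (j c) = j c by [].
rewrite /sigmaV /sigma /= (ctens_map_comp _ _ H) ?ctens_map_id //; exact: frobVK.
Qed.

Variable P : isocrystal F j.

Lemma iso_tau_bij : exists g, cancel (tau P) g /\ cancel g (tau P).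
Proof. exact: tau_bij sigmaK sigmaVK (iso_lin P). Qed.

Definition tauV : P -> P := projT1 (cid iso_tau_bij).

Lemma tauK : cancel (tau P) tauV.
Proof. by rewrite /tauV; case: cid => g []. Qed.
Lemma tauVK : cancel tauV (tau P).
Proof. by rewrite /tauV; case: cid => g []. Qed.

(* tau_P^m for m in Z                                                        *)
Definition tauz (m : int) : P -> P := zpow (tau P) tauV m.

Lemma tauVD x y : tauV (x + y) = tauV x + tauV y.
Proof. by apply: (can_inj tauK); rewrite tauVK tauD !tauVK. Qed.
Lemma tauVZ e x : tauV (e *: x) = sigmaV e *: tauV x.
Proof. by apply: (can_inj tauK); rewrite tauVK tauZ sigmaVK tauVK. Qed.

Lemma tauzD m x y : tauz m (x + y) = tauz m x + tauz m y.
Proof.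
case: m => n; rewrite /tauz /zpow.
  by elim: n => //= n ->; rewrite tauD.
by elim: n.+1 => //= {}n ->; rewrite tauVD.
Qed.

Lemma tauzZ m e x : tauz m (e *: x) = zpow sg sigmaV m e *: tauz m x.
Proof.
case: m => n; rewrite /tauz /zpow.
  by elim: n => //= n ->; rewrite tauZ.
by elim: n.+1 => //= {}n ->; rewrite tauVZ.
Qed.

Lemma tauz_tau m x : tauz m (tau P x) = tau P (tauz m x).
Proof.
case: m => n; rewrite /tauz /zpow; first by rewrite -iterSr.
by elim: n.+1 => //= {}n ->; rewrite tauK tauVK.
Qed.

Lemma hom_tauV (Q : taumod sg) (h : tmhom Q P) (hV : Q -> Q) x :
  cancel hV (tau Q) -> h (hV x) = tauV (h x).
Proof. by move=> hK; apply: (can_inj tauK); rewrite tauVK -hom_tau hK. Qed.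

End OverClosedField.

Lemma hom_tauz (Fq : finFieldType) (F : localField Fq) (L : closedFieldType)
    (j : {rmorphism Fq -> L}) (P Q : isocrystal F j) (h : tmhom Q P) m x :
  h (tauz m x) = tauz m (h x).
Proof.
case: m => n; rewrite /tauz /zpow; first by elim: n => //= n <-; rewrite hom_tau.
by elim: n.+1 => //= {}n <-; apply: hom_tauV; exact: tauVK.
Qed.

Section OverFiniteField.
Variables (Fq : finFieldType) (F : localField Fq) (k : fieldExtType Fq).

(* char_M = det(X - tau_M^[k:Fq])                                            *)
Definition iso_charpoly (M : isocrystal F (in_alg k)) : {poly ctens F (in_alg k)} :=
  charpoly (iter (\dim {:k}) (tau M)).

Variables (L : closedFieldType) (iota : {rmorphism k -> L}).

Definition emb_bar : {rmorphism Fq -> L} := iota \o in_alg k.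
Local Notation jL := emb_bar.
Local Notation E := (ctens F jL).

Definition iota_fin : {rmorphism finvect_type k -> L} := iota.

(* The subgroup W_k generated by Frob_k : x |-> x^|k|; its elements fix k.   *)
Record weil := Weil {
  weil_fun :> {rmorphism L -> L};
  weil_pow : exists m : int, weil_fun =1 frobz iota_fin m }.

Lemma frob_k_iter x : frob iota_fin x = iter (\dim {:k}) (frob jL) x.
Proof.
rewrite /frob.
have -> : #|finvect_type k| = (#|Fq| ^ \dim {:k})%N.
  have <- := @card_vspacef Fq (finvect_type k) (Vector.class (finvect_type k)).
  by rewrite card_vspace.
elim: (\dim _) => [|n IHn]; first by rewrite expr1.
by rewrite expnSr exprM IHn.
Qed.

Lemma frobV_k_iter x : frobV iota_fin x = iter (\dim {:k}) (frobV jL) x.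
Proof.
apply: (@frob_inj _ _ iota_fin); rewrite frobVK frob_k_iter.
by elim: (\dim _) => //= n IHn; rewrite -iterS iterSr frobVK.
Qed.

Lemma frobz_k m : frobz iota_fin m =1 frobz jL (m * (\dim {:k})%:Z).
Proof.
move=> x; rewrite !frobzE.
case: m => n.
  rewrite -PoszM /= mulnC; elim: n => [|n IHn] /=; first by rewrite muln0.
  by rewrite IHn mulnS iterD frob_k_iter.
have -> : Negz n * (\dim {:k})%:Z = - Posz (n.+1 * \dim {:k})%N.
  by rewrite NegzE mulNr PoszM.
have H p : zpow (frob jL) (frobV jL) (- Posz p) = iter p (frobV jL) by case: p.
rewrite H mulnC /zpow; elim: n.+1 => [|{}n IHn] /=; first by rewrite muln0.
by rewrite IHn mulnS iterD frobV_k_iter.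
Qed.

Implicit Types (gamma : weil).

Lemma weil_deg_ex gamma : exists d : int, gamma =1 frobz jL d.
Proof.
have [m hm] := weil_pow gamma; exists (m * (\dim {:k})%:Z) => x.
by rewrite hm frobz_k.
Qed.

(* The integer d with gamma = Frob_q^d; it is unique because L is infinite.  *)
Definition deg_q gamma : int := projT1 (cid (weil_deg_ex gamma)).

Lemma deg_qP gamma : gamma =1 frobz jL (deg_q gamma).
Proof. by rewrite /deg_q; case: cid. Qed.

Lemma weil_fix gamma c : gamma (iota c) = iota c.
Proof.
have [m ->] := weil_pow gamma; rewrite frobzE.
case: m => n; rewrite /zpow.
  by elim: n => //= n ->; exact: (frob_fix iota_fin).
by elim: n.+1 => //= {}n ->; exact: (frobV_fix iota_fin).
Qed.

Lemma weil_jL gamma c : gamma (jL c) = jL c.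
Proof. exact: weil_fix. Qed.

Program Definition Frob_k : weil := @Weil (frob iota_fin) _.
Next Obligation. by exists 1. Qed.

Lemma weil_inv_proof gamma :
  exists m : int, frobz iota_fin (- projT1 (cid (weil_pow gamma))) =1 frobz iota_fin m.
Proof. by eexists. Qed.
Definition weil_inv gamma : weil := Weil (weil_inv_proof gamma).

Lemma weil_invK gamma : cancel gamma (weil_inv gamma).
Proof.
rewrite /weil_inv /=; case: cid => m hm x /=; rewrite hm !frobzE.
exact: zpowVK (frobK _) (frobVK _) _ _.
Qed.

Definition weil_ctens gamma : {rmorphism E -> E} :=
  ctens_map (F := F) (weil_jL gamma).

Lemma iota_jL c : iota (in_alg k c) = jL c. Proof. by []. Qed.
Definition ctens_bar : {rmorphism ctens F (in_alg k) -> E} :=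
  ctens_map (F := F) iota_jL.

Lemma ctens_bar_sigma e :
  sigma F jL (ctens_bar e) = ctens_bar (sigma F (in_alg k) e).
Proof.
pose f : {rmorphism k -> L} := iota \o frob (in_alg k).
have fj c : f (in_alg k c) = jL c by rewrite /f /= frob_fix.
rewrite /ctens_bar /sigma /= (ctens_map_comp _ _ fj) ?(ctens_map_comp _ _ fj) //.
by move=> x /=; rewrite /frob rmorphXn.
Qed.

Lemma ctens_map_ext (K K' : fieldType) (j : {rmorphism Fq -> K})
   (j' : {rmorphism Fq -> K'}) (g g' : {rmorphism K -> K'})
   (gj : forall c, g (j c) = j' c) (gj' : forall c, g' (j c) = j' c) :
   g =1 g' -> ctens_map (F := F) gj =1 ctens_map (F := F) gj'.
Proof.
move=> gg' x.
have H : forall c, (idfun : {rmorphism K -> K}) (j c) = j c by [].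
by rewrite -(ctens_map_comp H gj gj') // ctens_map_id.
Qed.

Lemma weil_ctens_bar gamma e : weil_ctens gamma (ctens_bar e) = ctens_bar e.
Proof.
rewrite /weil_ctens /ctens_bar /= (ctens_map_comp _ _ iota_jL) // => x.
exact: weil_fix.
Qed.

Lemma weil_ctens_sigma gamma e :
  weil_ctens gamma (sigma F jL e) = sigma F jL (weil_ctens gamma e).
Proof.
pose f : {rmorphism L -> L} := frob jL \o gamma.
have fj c : f (jL c) = jL c by rewrite /f /= weil_fix frob_fix.
rewrite /weil_ctens /sigma /= (ctens_map_comp _ _ fj) ?(ctens_map_comp _ _ fj) //.
by move=> x /=; rewrite /frob rmorphXn.
Qed.

Lemma weil_ctensE gamma e :
  weil_ctens gamma e = zpow (sigma F jL) (sigmaV F jL) (deg_q gamma) e.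
Proof.
have rfix n (g : {rmorphism L -> L}) (gj : forall c, g (jL c) = jL c) c :
    riter n g (jL c) = jL c.
  by rewrite riterE; elim: n => //= n ->; rewrite gj.
have rE n (g : {rmorphism L -> L}) (gj : forall c, g (jL c) = jL c) x :
    iter n (ctens_map (F := F) gj) x = ctens_map (F := F) (rfix n g gj) x.
  elim: n => [|n IHn] /=; first by rewrite ctens_map_id.
  by rewrite IHn (ctens_map_comp _ _ (rfix n.+1 g gj)).
case e_d : (deg_q gamma) => [n|n]; rewrite /zpow /sigma /sigmaV /= -?iterS rE.
  by apply: ctens_map_ext => x; rewrite deg_qP e_d.
by apply: ctens_map_ext => x; rewrite deg_qP e_d.
Qed.

Lemma weil_ctens_zpow gamma e :
  weil_ctens gamma (zpow (sigma F jL) (sigmaV F jL) (- deg_q gamma) e) = e.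
Proof.
rewrite weil_ctensE -{1}[deg_q gamma]opprK.
exact: zpowVK (@sigmaK _ _ _ _) (@sigmaVK _ _ _ _) _ _.
Qed.

Variable M : isocrystal F (in_alg k).

(* The base change of M to L, with tau = sigma (x) tau_M.                    *)
Definition iso_bar : taumod (sigma F jL) := bc_taumod ctens_bar_sigma M.

Definition weil_bar gamma : iso_bar -> iso_bar :=
  bc_map (M := M) (weil_ctens gamma) id.

Let wbarE gamma e m : weil_bar gamma (bc_pure ctens_bar e m) =
  bc_pure ctens_bar (weil_ctens gamma e) m.
Proof. by rewrite /weil_bar (bc_mapE (r := id)) //; exact: weil_ctens_bar. Qed.

Lemma weil_barD gamma : {morph weil_bar gamma : x y / x + y}.
Proof. by apply: (bc_mapD (r := id)) => //; exact: weil_ctens_bar. Qed.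

Lemma weil_barZ gamma e x :
  weil_bar gamma (e *: x) = weil_ctens gamma e *: weil_bar gamma x.
Proof. by apply: (bc_mapZ (r := id)) => //; exact: weil_ctens_bar. Qed.

Lemma weil_bar_tau gamma x :
  weil_bar gamma (tau iso_bar x) = tau iso_bar (weil_bar gamma x).
Proof.
have tE e m : tau iso_bar (bc_pure ctens_bar e m)
    = bc_pure ctens_bar (sigma F jL e) (tau M m).
  exact: (bc_mapE ctens_bar_sigma (@tauD _ _ M) (@tauZ _ _ M)).
apply: (bc_ext (f := fun x => weil_bar gamma (tau iso_bar x))
  (h := fun x => tau iso_bar (weil_bar gamma x))) x => [x y|x y|e m].
- by rewrite tauD weil_barD.
- by rewrite weil_barD tauD.
- by rewrite tE !wbarE tE weil_ctens_sigma.
Qed.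

(* T_P(M), with W_k acting by f |-> (id (x) gamma) o f o tau_P^(- deg gamma) *)
Definition T_ (P : taumod (sigma F jL)) := tmhom P iso_bar.

Section WeilAction.
Variables (gamma : weil) (P : isocrystal F jL).

Definition weil_T_fun (f : T_ P) : P -> iso_bar :=
  fun p => weil_bar gamma (f (tauz (- deg_q gamma) p)).

Lemma weil_T_linear (f : T_ P) : linear (weil_T_fun f).
Proof.
move=> e x y; rewrite /weil_T_fun tauzD tauzZ homD homZ weil_barD weil_barZ.
by rewrite weil_ctens_zpow.
Qed.

Lemma weil_T_tau (f : T_ P) p :
  weil_T_fun f (tau P p) = tau iso_bar (weil_T_fun f p).
Proof. by rewrite /weil_T_fun tauz_tau hom_tau weil_bar_tau. Qed.

Definition weil_T (f : T_ P) : T_ P := TmHom (weil_T_linear f) (weil_T_tau f).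

Lemma weil_TD f h : weil_T (f + h) = weil_T f + weil_T h.
Proof. by apply: tmhom_ext => p /=; rewrite /weil_T_fun weil_barD. Qed.

(* U_P(M), with W_k acting through the first factor                          *)
Definition U_ (Q : taumod (sigma F jL)) : lmodType E := homtens Q iso_bar.

Definition weil_U : U_ P -> U_ P := ht_map weil_T id.

Lemma weil_U_bal : balanced (@ht_ra _ _ P iso_bar) (@ht_la _ _ P)
  (fun f p => ht_pure (weil_T f) p).
Proof.
have hb := ht_pure_bal P iso_bar.
split=> [x y z|x y z|x r y].
- by rewrite weil_TD (balDl hb).
- by rewrite (balDr hb).
- have -> : weil_T (ht_ra x r) = ht_ra (weil_T x) r.
    by apply: tmhom_ext => p /=; rewrite /weil_T_fun /= hom_tauz.
  by rewrite (balM hb).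
Qed.

Lemma weil_UE f p : weil_U (ht_pure f p) = ht_pure (weil_T f) p.
Proof. exact: (ht_mapE weil_U_bal). Qed.

Lemma weil_U_linear : linear weil_U.
Proof. exact: (ht_map_linear weil_U_bal). Qed.

End WeilAction.

Lemma weil_U_transition gamma (P P' : isocrystal F jL) (i : tmhom P P')
    (p : tmhom P' P) (pK : cancel i p) x :
  transition iso_bar i p (weil_U gamma x) = weil_U gamma (transition iso_bar i p x).
Proof.
have wD (Q : isocrystal F jL) := ht_mapD (weil_U_bal gamma Q).
have tD := ht_mapD (transition_bal iso_bar pK).
apply: (ht_ext (f := fun x => transition iso_bar i p (weil_U gamma x))
  (h := fun x => weil_U gamma (transition iso_bar i p x))) x => [y z|y z|f y].
- by rewrite /weil_U /transition wD tD.
- by rewrite /weil_U /transition tD wD.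
- rewrite weil_UE !(transitionE pK) weil_UE; congr ht_pure.
  by apply: tmhom_ext => z /=; rewrite /weil_T_fun /= hom_tauz.
Qed.

Record U_cocone (V : lmodType E) (v : forall P : isocrystal F jL, U_ P -> V) :
    Prop := UCocone {
  cocone_linear : forall P, linear (v P);
  cocone_compat : forall (P P' : isocrystal F jL)
      (i : tmhom P P') (p : tmhom P' P),
    cancel i p -> forall x, v P' (transition iso_bar i p x) = v P x }.

(* The direct limit U(M), given by its universal property, since P ranges
   over all isocrystals over L (a large type).                               *)
Record dirlim := Dirlim {
  dl_mod :> lmodType E;
  dl_can : forall P : isocrystal F jL, U_ P -> dl_mod;
  dl_cocone : U_cocone (@dl_can);
  dl_univ : forall (V : lmodType E) (v : forall P : isocrystal F jL, U_ P -> V),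
    U_cocone v ->
    exists! w : dl_mod -> V, (linear w /\ forall P (x : U_ (iso_tm P)), w (dl_can x) = v P x)%type }.

Variable U : dirlim.

Lemma weil_dirlim_cocone gamma :
  U_cocone (fun P x => @dl_can U P (weil_U gamma x)).
Proof.
have [lin comp] := dl_cocone U; split=> [P e x y|P P' i p pK x].
  by rewrite weil_U_linear lin.
by rewrite -(weil_U_transition gamma pK) comp.
Qed.

Definition weil_dirlim gamma : U -> U :=
  projT1 (cid (@dl_univ U _ _ (weil_dirlim_cocone gamma))).

Lemma weil_dirlim_linear gamma : linear (weil_dirlim gamma).
Proof. by rewrite /weil_dirlim; case: cid => w [[]]. Qed.

Lemma weil_dirlimE gamma P x :
  weil_dirlim gamma (@dl_can U P x) = @dl_can U P (weil_U gamma x).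
Proof. by rewrite /weil_dirlim; case: cid => w [[]]. Qed.

End OverFiniteField.

Arguments dl_can {Fq F k L iota M} d P x.
Arguments weil_dirlim {Fq F k L iota M} U gamma x.

(* Main.v *)
(* Evaluation h (x) p |-> h(p) maps U_P(M) to the base change Mbar of M, and it
   is an isomorphism once Mbar is a direct summand of P, in particular for
   P = Mbar.  Comparing P and Mbar inside P (+) Mbar identifies the direct limit
   U(M) with Mbar, where gamma acts by (id (x) gamma) o tau^(-deg gamma).  With
   d = [k : Fq], Frob_k^-1 has degree -d, so it acts by e (x) m |-> e (x) tau_M^d(m):
   it is the base change of the linear map tau_M^d.                          *)
From HB Require Import structures.
Require Import Defs.
From mathcomp Require Import all_boot all_order all_fingroup all_algebra all_field.
From mathcomp Require Import boolp.

Set Implicit Arguments.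
Unset Strict Implicit.
Unset Printing Implicit Defensive.

Import GRing.Theory.
Local Open Scope ring_scope.

Definition linear_pack (E : comNzRingType) (M N : lmodType E) (f : M -> N)
    (f_lin : linear f) : {linear M -> N} :=
  HB.pack f (GRing.isLinear.Build E M N *:%R f f_lin).

(** * Bijectivity of the linearization of a semilinear map *)

Section Linearization.
Variables (E : comNzRingType) (s si : {rmorphism E -> E}) (M : taumod s).
Variable t : M -> M.
Hypothesis siK : cancel si s.
Hypotheses (tauK : cancel (tau M) t) (tauVK : cancel t (tau M)).

Lemma tau_invD x y : t (x + y) = t x + t y.
Proof. by apply: (can_inj tauK); rewrite tauVK tauD !tauVK. Qed.

Lemma tau_invZ e x : t (e *: x) = si e *: t x.
Proof. by apply: (can_inj tauK); rewrite tauVK tauZ siK tauVK. Qed.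

(** Converse of [tau_bij]. Since [e = s (si e)], the tensor of [e] and [m] equals that of 1 and
    [si e *: m]: every scalar moves to the right factor, where [t] undoes [tau]. *)
Lemma linearization_bijective : bijective (@linearization _ s M).
Proof.
exists (fun x => bc_pure s 1 (t x)) => x; last by rewrite linearizationE scale1r.
apply: (bc_ext (f := fun x => bc_pure s 1 (t (linearization x))) (h := id)) x.
- move=> x y; rewrite /linearization (tliftD (linearization_bal M)) tau_invD.
  exact: (balDr (bc_pure_bal s M)).
- by [].
move=> e m; rewrite linearizationE tau_invZ tauK.
by rewrite -/(bc_la _ m) -(balM (bc_pure_bal s M)) /bc_ra siK mul1r.
Qed.

End Linearization.

(** * Direct summands and characteristic polynomials under base change and isomorphism *)

Section SummandBaseChange.
Variables (E E' : comNzRingType) (g : {rmorphism E -> E'}) (M : lmodType E).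
Variable D : summand M.
Local Notation bcp := (bc_pure g).

Lemma bc_inj_bal : balanced (bc_ra g) (@bc_la E M)
  (fun e m => e *: map_mx g (sm_inj D m)).
Proof.
split=> [x y z|x y z|x r y]; first by rewrite scalerDl.
  by rewrite linearD map_mxD scalerDr.
by rewrite /bc_ra /bc_la linearZ /= map_mxZ scalerA.
Qed.

Definition bc_inj : bctens g M -> 'rV[E']_(sm_n D) :=
  tlift (fun e m => e *: map_mx g (sm_inj D m)).

Lemma bc_injE e m : bc_inj (bcp e m) = e *: map_mx g (sm_inj D m).
Proof. exact: tlift_pure bc_inj_bal. Qed.

Lemma bc_inj_linear : linear bc_inj.
Proof.
have bcD := tliftD bc_inj_bal; move=> a x y; rewrite /bc_inj bcD.
congr (_ + _); apply: (bc_ext (f := fun x => bc_inj (a *: x))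
  (h := fun x => a *: bc_inj x)) x => [u v|u v|e m].
- by rewrite scalerDr /bc_inj bcD.
- by rewrite /bc_inj bcD scalerDr.
- by rewrite bc_scale_pure !bc_injE scalerA.
Qed.

(** The base change of [sm_proj D], written on the standard basis. *)
Definition bc_proj (v : 'rV[E']_(sm_n D)) : bctens g M :=
  \sum_i v 0 i *: bcp 1 (sm_proj D (delta_mx 0 i)).

Lemma bc_proj_linear : linear bc_proj.
Proof.
move=> a u v; rewrite /bc_proj scaler_sumr -big_split /=; apply: eq_bigr => i _.
by rewrite !mxE scalerDl scalerA.
Qed.

Lemma bc_proj_map u : bc_proj (map_mx g u) = bcp 1 (sm_proj D u).
Proof.
rewrite [in RHS](row_sum_delta u) linear_sum /bc_proj.
have sumE (I : Type) (r : seq I) (f : I -> M) :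
    \sum_(i <- r) bcp 1 (f i) = bcp 1 (\sum_(i <- r) f i).
  elim: r => [|i r IHr]; first by rewrite !big_nil (bal0r _ (bc_pure_bal g M)).
  by rewrite !big_cons IHr (balDr (bc_pure_bal g M)).
rewrite -sumE; apply: eq_bigr => i _; rewrite mxE bc_scale_pure linearZ /=.
by rewrite -/(bc_la _ _) -(balM (bc_pure_bal g M)) /bc_ra mul1r mulr1.
Qed.

Lemma bc_inj_projK : cancel bc_inj bc_proj.
Proof.
pose proj := linear_pack bc_proj_linear; pose inj := linear_pack bc_inj_linear.
apply: (bc_ext (f := fun x => proj (inj x)) (h := id)) => // [x y|e m].
  by rewrite !linearD.
rewrite /= bc_injE -[bc_proj]/(GRing.Linear.sort proj) linearZ /=.
by rewrite bc_proj_map sm_K bc_scale_pure mulr1.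
Qed.

Definition bc_summand : summand (bctens g M) :=
  @Summand _ _ _ (linear_pack bc_inj_linear) (linear_pack bc_proj_linear)
    bc_inj_projK.

(** The matrix of [h] only involves [h] at the tensors of 1 with the projected basis vectors, so the
    values on [bcp 1 m] determine it. *)
Lemma bc_summand_mx (f : M -> M) (h : bctens g M -> bctens g M) :
  (forall m, h (bcp 1 m) = bcp 1 (f m)) ->
  summand_mx bc_summand bc_summand h = map_mx g (summand_mx D D f).
Proof.
move=> hE; apply/matrixP => i j; rewrite !mxE /=.
by rewrite -(map_delta_mx g) bc_proj_map hE bc_injE scale1r mxE.
Qed.

Lemma charpoly_of_bc (f : M -> M) (h : bctens g M -> bctens g M) :
  (forall m, h (bcp 1 m) = bcp 1 (f m)) ->
  charpoly_of bc_summand h = map_poly g (charpoly_of D f).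
Proof.
move=> hE; rewrite /charpoly_of -det_map_mx (bc_summand_mx hE).
rewrite (@bc_summand_mx id id) //; congr (\det _).
rewrite map_mxD map_mxB map_mxD map_mxN map_mx1 map_mxZ /= map_polyX.
have mC n (A : 'M[E]_n) :
    map_mx (map_poly g) (map_mx polyC A) = map_mx polyC (map_mx g A).
  by apply/matrixP => i j; rewrite !mxE map_polyC.
by rewrite !mC.
Qed.

End SummandBaseChange.

Lemma charpoly_bc (E E' : comNzRingType) (g : {rmorphism E -> E'})
    (M : lmodType E) (f : {linear M -> M})
    (h : {linear bctens g M -> bctens g M}) :
  fg_projective M -> (forall m, h (bc_pure g 1 m) = bc_pure g 1 (f m)) ->
  charpoly h = map_poly g (charpoly f).
Proof.
move=> [D _] hE; rewrite (charpolyE D) (charpolyE (bc_summand g D)).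
exact: charpoly_of_bc.
Qed.

(** Pulling a summand structure of [M] back along [w] gives one of [N] in which [h] has literally
    the matrix of [f]; by [charpolyE] this structure may be used to compute. *)
Lemma charpoly_conj (E : comNzRingType) (M N : lmodType E)
    (w : {linear N -> M}) (w' : {linear M -> N})
    (f : {linear M -> M}) (h : {linear N -> N}) :
  fg_projective M -> cancel w w' -> cancel w' w ->
  (forall x, w (h x) = f (w x)) -> charpoly h = charpoly f.
Proof.
move=> [D _] wK w'K whf.
have K : cancel (sm_inj D \o w) (w' \o sm_proj D).
  by move=> x /=; rewrite sm_K wK.
have mxK (f0 : M -> M) (h0 : N -> N) : (forall x, w (h0 x) = f0 (w x)) ->
    summand_mx (Summand K) (Summand K) h0 = summand_mx D D f0.
  by move=> fh0; apply/matrixP => i j; rewrite !mxE /= fh0 w'K.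
rewrite (charpolyE D) (charpolyE (Summand K)) /charpoly_of (mxK f h) //.
by rewrite (mxK id id).
Qed.

(** * Evaluation of homomorphisms *)

Definition hom_id (E : comNzRingType) (s : E -> E) (P : taumod s) : tmhom P P.
Proof. by exists id. Defined.

Section Evaluation.
Variables (E : comNzRingType) (s : E -> E) (P Q : taumod s).

Lemma ht_eval_bal : balanced (@ht_ra E s P Q) (@ht_la E s P)
  (fun (h : tmhom P Q) p => h p).
Proof. by split=> // h x y; rewrite homD. Qed.

Definition ht_eval : homtens P Q -> Q := tlift (fun (h : tmhom P Q) p => h p).

Lemma ht_evalE h p : ht_eval (ht_pure h p) = h p.
Proof. exact: tlift_pure ht_eval_bal. Qed.

Lemma ht_evalD : {morph ht_eval : x y / x + y}.
Proof. exact: tliftD ht_eval_bal. Qed.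

Lemma ht_eval_linear : linear ht_eval.
Proof.
move=> e x y; rewrite ht_evalD; congr (_ + _).
apply: (ht_ext (f := fun x => ht_eval (e *: x))
  (h := fun x => e *: ht_eval x)) x => [u v|u v|h p].
- by rewrite scalerDr ht_evalD.
- by rewrite ht_evalD scalerDr.
- by rewrite ht_scale_pure !ht_evalE homZ.
Qed.

(* Since h = pi (i h) with i h in End(P), h (x) y = pi (x) i (h y): evaluation
   is bijective as soon as Q is a direct summand of P.                       *)
Lemma ht_evalK (i : tmhom Q P) (pi : tmhom P Q) : cancel i pi ->
  cancel ht_eval (fun y => ht_pure pi (i y)).
Proof.
move=> iK; have hb := ht_pure_bal P Q.
apply: (ht_ext (f := fun x => ht_pure pi (i (ht_eval x))) (h := id)) => //.
  by move=> x y; rewrite ht_evalD homD (balDr hb).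
move=> h p; rewrite ht_evalE -[i (h p)]/(ht_la (hom_comp i h) p) -(balM hb).
by congr ht_pure; apply: tmhom_ext => x /=; rewrite iK.
Qed.

End Evaluation.

(** On pure tensors, [h (pi (i p)) = h p]. This is what lets evaluation descend to the direct
    limit. *)
Lemma ht_eval_transition (E : comNzRingType) (s : E -> E) (P P' Q : taumod s)
    (i : tmhom P P') (pi : tmhom P' P) : cancel i pi ->
  forall x, ht_eval (transition Q i pi x) = ht_eval x.
Proof.
move=> iK; apply: (ht_ext (f := fun x => ht_eval (transition Q i pi x))).
- by move=> x y; rewrite /transition (ht_mapD (transition_bal Q iK)) ht_evalD.
- exact: ht_evalD.
- by move=> h p; rewrite transitionE // !ht_evalE /= iK.
Qed.

(** * Direct sums, which dominate two given isocrystals in the direct system *)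

Section DirectSum.
Variables (E : comNzRingType) (s : {rmorphism E -> E}) (P Q : taumod s).

Definition tau_sum (x : P * Q) : P * Q := (tau P x.1, tau Q x.2).

Lemma tau_sumD x y : tau_sum (x + y) = tau_sum x + tau_sum y.
Proof. by rewrite /tau_sum !tauD. Qed.

Lemma tau_sumZ e x : tau_sum (e *: x) = s e *: tau_sum x.
Proof. by rewrite /tau_sum !tauZ. Qed.

Definition taumod_sum : taumod s := TauMod tau_sumD tau_sumZ.

Definition sum_inl : tmhom P taumod_sum.
Proof.
exists (fun x => (x, 0)) => [e x y|x]; last by rewrite /= /tau_sum /= tau0.
by apply/pair_equal_spec; rewrite /= scaler0 addr0.
Defined.

Definition sum_inr : tmhom Q taumod_sum.
Proof.
exists (fun x => (0, x)) => [e x y|x]; last by rewrite /= /tau_sum /= tau0.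
by apply/pair_equal_spec; rewrite /= scaler0 addr0.
Defined.

Definition sum_fst : tmhom taumod_sum P.
Proof. by exists fst. Defined.

Definition sum_snd : tmhom taumod_sum Q.
Proof. by exists snd. Defined.

Lemma fg_projective_sum :
  fg_projective P -> fg_projective Q -> fg_projective taumod_sum.
Proof.
move=> [[n iP pP iPK] _] [[m iQ pQ iQK] _].
have inj_lin : linear (fun x : P * Q => row_mx (iP x.1) (iQ x.2)).
  by move=> e x y; rewrite !linearP scale_row_mx add_row_mx.
have proj_lin : linear (fun v => (pP (lsubmx v), pQ (rsubmx v)) : P * Q).
  by move=> e u v; rewrite !linearP.
have K : cancel (linear_pack inj_lin) (linear_pack proj_lin).
  by case=> x y; rewrite /= row_mxKl row_mxKr iPK iQK.
by exists (Summand K).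
Qed.

End DirectSum.

Definition iso_sum (Fq : finFieldType) (F : localField Fq) (L : closedFieldType)
  (j : {rmorphism Fq -> L}) (P Q : isocrystal F j) : isocrystal F j.
Proof.
exists (taumod_sum P Q).
  by apply: fg_projective_sum; apply: iso_fgp.
apply: (@linearization_bijective _ (sigma F j) (sigmaV F j) (taumod_sum P Q)
  (fun x => (tauV x.1, tauV x.2)) (@sigmaVK _ F _ j)).
- by case=> x y; rewrite /= !tauK.
- by case=> x y; rewrite /= /tau_sum /= !tauVK.
Defined.

(** * Powers of the Frobenius over a finite field *)

Lemma iter_ctens_map (Fq : finFieldType) (F : localField Fq) (K : fieldType)
    (j : {rmorphism Fq -> K}) (g : {rmorphism K -> K})
    (gj : forall c, g (j c) = j c) n (gnj : forall c, riter n g (j c) = j c) :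
  iter n (ctens_map (F := F) gj) =1 ctens_map (F := F) gnj.
Proof.
have rj m c : riter m g (j c) = j c by rewrite riterE; elim: m => //= m ->.
(* The induced map does not depend on the proof that the iterate fixes the image of [j], so the
   uniform proof [rj] can carry the induction. *)
move=> x; rewrite (@ctens_map_ext _ _ _ _ _ _ _ _ gnj (rj n)) //.
elim: n {gnj} => [|n IHn] /=; first by rewrite ctens_map_id.
by rewrite IHn (ctens_map_comp _ _ (rj n.+1)).
Qed.

Section OverFinite.
Variables (Fq : finFieldType) (F : localField Fq) (k : fieldExtType Fq).
Local Notation jk := (in_alg k).
Local Notation d := (\dim {:k}).

Lemma card_ext_field : #|finvect_type k| = (#|Fq| ^ d)%N.
Proof.
have <- := @card_vspacef Fq (finvect_type k) (Vector.class (finvect_type k)).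
by rewrite card_vspace.
Qed.

Lemma iter_frob (K : fieldType) (j : {rmorphism Fq -> K}) n x :
  iter n (frob j) x = x ^+ (#|Fq| ^ n).
Proof.
elim: n => [|n IHn] /=; first by rewrite expr1.
by rewrite IHn /frob -exprM -expnSr.
Qed.

Lemma iter_frob_dim : iter d (frob jk) =1 id.
Proof.
move=> x; rewrite iter_frob -card_ext_field.
exact: (@expf_card (finvect_type k) x).
Qed.

(** Every x in k satisfies $x^{|k|} = x$, and functoriality carries this over to [sigma]. Hence
    $\tau_M^d$ is linear and [sigma] is invertible over k. *)
Lemma iter_sigma_dim : iter d (sigma F jk) =1 id.
Proof.
have rj c : riter d (frob jk) (jk c) = jk c by rewrite riterE iter_frob_dim.
move=> e; rewrite (iter_ctens_map _ rj) ctens_map_id // => x.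
by rewrite riterE iter_frob_dim.
Qed.

Lemma sigma_inv_fix c : riter d.-1 (frob jk) (jk c) = jk c.
Proof. by rewrite riterE; elim: d.-1 => //= n ->; exact: (frob_fix jk). Qed.

(** This is $\sigma^{d-1}$, written as the map induced by a power of the Frobenius so that it is a
    ring morphism by construction. *)
Definition sigma_inv : {rmorphism ctens F jk -> ctens F jk} :=
  ctens_map (F := F) sigma_inv_fix.

Lemma sigma_invE : sigma_inv =1 iter d.-1 (sigma F jk).
Proof. by move=> e; rewrite (iter_ctens_map _ sigma_inv_fix). Qed.

Lemma dim_fieldS : d = d.-1.+1.
Proof. by rewrite prednK // (adim_gt0 {:k}%AS). Qed.

Lemma sigmaK_fin : cancel (sigma F jk) sigma_inv.
Proof. by move=> e; rewrite sigma_invE -iterSr -dim_fieldS iter_sigma_dim. Qed.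

Lemma sigma_invK : cancel sigma_inv (sigma F jk).
Proof. by move=> e; rewrite sigma_invE -iterS -dim_fieldS iter_sigma_dim. Qed.

Variable M : isocrystal F jk.

Lemma iter_tau_linear : linear (iter d (tau M)).
Proof.
(* Writing the scalar on the right as $\sigma^d(e)$ gives an identity valid for every exponent,
   hence open to induction. *)
move=> e x y; rewrite -{2}[e]iter_sigma_dim.
by elim: d => //= n ->; rewrite tauD tauZ.
Qed.

(** * Base change to the closed field, and the degree of the Frobenius *)

Variables (L : closedFieldType) (iota : {rmorphism k -> L}).
Local Notation g := (ctens_bar F iota).
Local Notation jL := (emb_bar iota).

Lemma ctens_bar_sigmaV e : sigmaV F jL (g e) = g (sigma_inv e).
Proof.
by apply: (can_inj (@sigmaK _ F _ jL)); rewrite sigmaVK ctens_bar_sigma sigma_invK.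
Qed.

(** This makes Mbar itself an index of the direct system; the inverse of its [tau] is $\sigma^{-1}$
    tensored with $\tau_M^{-1}$. It stays transparent so that its module converts to
    [iso_bar iota M]. *)
Definition iso_bar_iso : isocrystal F jL.
Proof.
exists (iso_bar iota M); first by case: (iso_fgp M) => D _; exists (bc_summand g D).
have [t [tK tVK]] := tau_bij sigmaK_fin sigma_invK (iso_lin M).
have tD := tau_invD tK tVK; have tZ := tau_invZ sigma_invK tK tVK.
have tE := bc_mapE (ctens_bar_sigma iota (F := F)) (@tauD _ _ M) (@tauZ _ _ M).
have tbarE := bc_mapE ctens_bar_sigmaV tD tZ.
have tbarD := bc_mapD ctens_bar_sigmaV tD tZ.
apply: (@linearization_bijective _ (sigma F jL) (sigmaV F jL) (iso_bar iota M)
  (bc_map (sigmaV F jL) t) (@sigmaVK _ F _ jL)).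
- apply: (bc_ext (f := fun x => bc_map _ t (tau (iso_bar iota M) x)) (h := id)) => //.
    by move=> x y; rewrite tauD tbarD.
  by move=> e m; rewrite /= tE tbarE sigmaK tK.
- apply: (bc_ext (f := fun x => tau (iso_bar iota M) (bc_map _ t x)) (h := id)) => //.
    by move=> x y; rewrite tbarD tauD.
  by move=> e m; rewrite /= tbarE tE sigmaVK tVK.
Defined.

(** [deg_q] is a chosen exponent, so its value rests on uniqueness: distinct powers of
    $\mathrm{Frob}_q$ differ somewhere on [L]. *)
Lemma deg_q_inv_Frob_k : deg_q (weil_inv (Frob_k iota)) = - d%:Z.
Proof.
have q_gt1 : (1 < #|Fq|)%N by exact: card_finNzRing_gt1.
have K x : frobz jL (deg_q (weil_inv (Frob_k iota))) (iter d (frob jL) x) = x.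
  by rewrite -deg_qP -frob_k_iter; exact: (weil_invK (Frob_k iota)).
have inj n m : (n < m)%N -> exists x, iter n (frob jL) x != iter m (frob jL) x.
  (* A root x of X^(q^m) - X^(q^n) + 1 separates the two powers.             *)
  move=> lt_nm; apply: contrapT => noex.
  pose p : {poly L} := 'X^(#|Fq| ^ m) - 'X^(#|Fq| ^ n).
  have sz_p : size p = (#|Fq| ^ m).+1.
    by rewrite size_polyDl ?size_polyN ?size_polyXn // ltnS ltn_exp2l.
  have sz_p1 : size (p + 1) = (#|Fq| ^ m).+1.
    by rewrite size_polyDl ?sz_p ?size_poly1 // ltnS expn_gt0 ltnW.
  have /closed_rootP[x /rootP] : size (p + 1) != 1%N.
    by rewrite sz_p1 eqSS -lt0n expn_gt0 ltnW.
  rewrite !hornerE -!(iter_frob jL) => px; apply: noex; exists x.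
  apply/eqP => e; move: px; rewrite e subrr add0r => /eqP.
  by rewrite oner_eq0.
(* A degree n >= 0 would make $\mathrm{Frob}_q^{n+d}$ the identity although n + d > 0. Otherwise the
   degree is [Negz n], that is -(n+1), and $\mathrm{Frob}_q^d = \mathrm{Frob}_q^{n+1}$ forces d = n
   + 1. *)
case: (deg_q _) K => n K.
  have [|x /eqP[]] := inj 0%N (n + d)%N; first by rewrite dim_fieldS addnS.
  by rewrite iterD -{1}(K x) frobzE.
have {}K x : iter d (frob jL) x = iter n.+1 (frob jL) x.
  rewrite -[in RHS](K x) frobzE.
  exact/esym/(zpowVK (@frobK _ _ jL) (@frobVK _ _ jL) (Negz n)).
rewrite NegzE; congr (- Posz _); case: (ltngtP d n.+1) => // /inj[x /eqP[]];
  by rewrite K.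
Qed.

(** * Identification of the direct limit with Mbar *)

Variable U : dirlim iota M.

(** Both maps factor the same cocone, so uniqueness in the universal property applies. *)
Lemma dirlim_ext (V : lmodType (ctens F jL)) (f h : {linear U -> V}) :
  (forall P x, f (dl_can U P x) = h (dl_can U P x)) -> f =1 h.
Proof.
move=> fh; have [lin comp] := dl_cocone U.
have fU : U_cocone (fun P x => f (dl_can U P x)).
  split=> [P e x y|P P' i p iK x]; first by rewrite lin linearP.
  by rewrite (comp _ _ i).
have [w [_ w_uniq]] := dl_univ U fU.
have <- : w = f by apply: w_uniq; split=> // e x y; rewrite linearP.
have <- // : w = h.
by apply: w_uniq; split=> [e x y|P x]; rewrite ?linearP ?fh.
Qed.

Lemma ht_eval_cocone :
  U_cocone (fun (P : isocrystal F jL) => @ht_eval _ _ P (iso_bar iota M)).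
Proof.
split=> [P|P P' i p iK x]; first exact: ht_eval_linear.
exact: ht_eval_transition.
Qed.

(** The universal property turns evaluation into [w]; the inverse sends y to the class of the tensor
    of the identity and y at the index Mbar. *)
Lemma dirlim_iso : exists (w : {linear U -> iso_bar iota M})
    (w' : {linear iso_bar iota M -> U}),
  [/\ cancel w w', cancel w' w & forall P x, w (dl_can U P x) = ht_eval x].
Proof.
have [lin comp] := dl_cocone U.
have [w0 [[w0_lin w0E] _]] := dl_univ U ht_eval_cocone.
pose N := iso_bar_iso; pose w := linear_pack w0_lin.
pose c y := dl_can U N (ht_pure (hom_id N) y).
have c_lin : linear c.
  move=> e x y; rewrite /c -lin ht_scale_pure.
  by rewrite (balDr (ht_pure_bal N N)).
have cw : cancel w (linear_pack c_lin).
  apply: (@dirlim_ext _ (linear_pack c_lin \o w) idfun) => P x.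
  rewrite /= w0E /c; pose Q := iso_sum P N.
  (* Both classes are pushed to the index [Q], where evaluation is injective because Mbar is a
     summand; there they have the same value. *)
  rewrite -(comp P Q (sum_inl P N) (sum_fst P N)) //.
  rewrite -(comp N Q (sum_inr P N) (sum_snd P N)) //; congr (dl_can U Q _).
  apply: (can_inj (@ht_evalK _ _ Q N (sum_inr P N) (sum_snd P N) _)) => //.
  by rewrite !ht_eval_transition // ht_evalE.
exists w, (linear_pack c_lin); split=> // x.
by rewrite /= w0E ht_evalE.
Qed.

(** Homomorphisms commute with all powers of [tau], so the twist by $\tau_P^{-\deg}$ passes through
    [h] and becomes a twist on Mbar. *)
Lemma weil_U_eval gamma (P : isocrystal F jL) (x : U_ M P) :
  ht_eval (weil_U gamma x) = weil_T gamma (hom_id iso_bar_iso) (ht_eval x).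
Proof.
have hT := homD (weil_T gamma (hom_id iso_bar_iso)).
apply: (ht_ext (f := fun x => ht_eval (weil_U gamma x))
  (h := fun x => weil_T gamma (hom_id iso_bar_iso) (ht_eval x))) x.
- by move=> x y; rewrite /weil_U (ht_mapD (weil_U_bal M gamma P)) ht_evalD.
- by move=> x y; rewrite ht_evalD hT.
move=> h p; rewrite weil_UE !ht_evalE /= /weil_T_fun /=.
by rewrite (@hom_tauz _ _ _ _ iso_bar_iso P h).
Qed.

(** The degree is -d, so the twist is by $\tau^d$; [sigma] and the Weil element both fix 1, and only
    $\tau_M^d$ on the right factor survives. *)
Lemma weil_T_inv_Frob_k m :
  weil_T (weil_inv (Frob_k iota)) (hom_id iso_bar_iso) (bc_pure g 1 m) =
  bc_pure g 1 (iter d (tau M) m).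
Proof.
rewrite /= /weil_T_fun deg_q_inv_Frob_k opprK /tauz /=.
have -> : iter d (bc_map (sigma F jL) (tau M)) (bc_pure g 1 m) =
    bc_pure g 1 (iter d (tau M) m).
  elim: d => //= n ->.
  have tE := bc_mapE (ctens_bar_sigma iota (F := F)) (@tauD _ _ M) (@tauZ _ _ M).
  by rewrite tE rmorph1.
rewrite /weil_bar (bc_mapE (r := id)) ?rmorph1 //.
exact: weil_ctens_bar.
Qed.

End OverFinite.

Theorem corollary8p9 (Fq : finFieldType) (F : localField Fq)
    (k : fieldExtType Fq) (kbar : closedFieldType)
    (iota : {rmorphism k -> kbar})
    (kbar_alg : forall x : kbar, algebraicOver iota x)
    (M : isocrystal F (in_alg k)) (U : dirlim iota M) :
  map_poly (ctens_bar F iota) (iso_charpoly M) =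
  charpoly (weil_dirlim U (weil_inv (Frob_k iota))).
Proof.
set gamma := weil_inv _.
pose f := linear_pack (iter_tau_linear (M := M)).
pose h : {linear iso_bar iota M -> iso_bar iota M} :=
  linear_pack (hom_linear (weil_T gamma (hom_id (iso_bar_iso M iota)))).
pose u := linear_pack (weil_dirlim_linear (U := U) gamma).
have [w [w' [wK w'K wE]]] := dirlim_iso U.
(* [h] is linear and agrees on the tensors of 1 and m with the base change of $\tau_M^d$. *)
have bcE : charpoly h = map_poly (ctens_bar F iota) (charpoly f).
  by apply: charpoly_bc; [exact: iso_fgp|exact: weil_T_inv_Frob_k].
rewrite -[LHS]bcE -[RHS]/(charpoly u); apply/esym.
apply: (charpoly_conj (iso_fgp (iso_bar_iso M iota)) wK w'K).
(* That [w] intertwines [u] and [h] is checked on the images of the $U_P(M)$. *)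
apply: (dirlim_ext (f := w \o u) (h := h \o w)) => P x.
by rewrite /= weil_dirlimE !wE weil_U_eval.
Qed.
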